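(* Let $H_1,H_2$ be Hermitian matrices, $f_1,f_2:[0,T]\to\mathbb{R}$ twice continuously differentiable, $H(t)=f_1(t)H_1+f_2(t)H_2$, and $0<h\le T$. Writing $\|f\|$ for $\|f\|_\infty$, the one-step errors satisfy: (1) $\|U_{s,1}(h,0)-U(h,0)\|\le \alpha_{s,1}h^2+\beta_{s,1}h^3$ with $\alpha_{s,1}=\frac12\|f_1'\|\|H_1\|+\frac12\|f_2'\|\|H_2\|+\frac12\|f_1\|\|f_2\|\|[H_1,H_2]\|$ and $\beta_{s,1}=\frac16\|f_1\|\|f_2'\|\|[H_1,H_2]\|$. (2) $\|U_{g,1}(h,0)-U(h,0)\|\le\alpha_{g,1}h^2$ with $\alpha_{g,1}=\frac12\|f_1\|\|f_2\|\|[H_1,H_2]\|$. (3) $\|U_{s,2}(h,0)-U(h,0)\|\le\alpha_{s,2}h^3+\beta_{s,2}h^4+\gamma_{s,2}h^5$ with $\alpha_{s,2}=\frac{7}{24}\|f_1''\|\|H_1\|+\frac1{12}\|f_1'\|\|f_2\|\|H_1\|+\frac7{24}\|f_2''\|\|H_2\|+\frac16(\|f_1'\|\|f_2\|+\|f_1\|\|f_2'\|)\|[H_1,H_2]\|+\frac1{24}\|f_1\|^2\|f_2\|\|[H_1,[H_1,H_2]]\|+\frac1{12}\|f_1\|\|f_2\|^2\|[H_2,[H_1,H_2]]\|$, $\beta_{s,2}=\frac1{64}\|f_1'\|\|f_2'\|\|H_1\|+\big(\frac1{192}\|f_1\|\|f_2''\|+\frac1{192}\|f_1''\|\|f_2\|+\frac1{48}\|f_1'\|\|f_2'\|\big)\|[H_1,H_2]\|+\frac1{96}\|f_1\|\|f_1'\|\|f_2\|\|[H_1,[H_1,H_2]]\|+\frac1{48}\|f_1\|\|f_2\|\|f_2'\|\|[H_2,[H_1,H_2]]\|$,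 $\gamma_{s,2}=\frac1{960}\|f_1'\|^2\|f_2\|\|[H_1,[H_1,H_2]]\|+\frac1{480}\|f_1\|\|f_2'\|^2\|[H_2,[H_1,H_2]]\|$. (4) $\|U_{g,2}(h,0)-U(h,0)\|\le\alpha_{g,2}h^3$ with $\alpha_{g,2}=\big(\frac7{12}\|f_1\|\|f_2'\|+\frac{11}{24}\|f_1'\|\|f_2\|\big)\|[H_1,H_2]\|+\frac38\|f_1\|^2\|f_2\|\|[H_1,[H_1,H_2]]\|+\frac1{12}\|f_1\|\|f_2\|^2\|[H_2,[H_2,H_1]]\|$.
   Context: $\|\cdot\|$ on matrices is the operator 2-norm; $\|f\|_\infty=\sup_{t\in[0,T]}|f(t)|$. $U(t,s)$ is the exact evolution: $\partial_tU(t,s)=-\mathrm{i} H(t)U(t,s)$, $U(s,s)=I$. The Trotter steps are $U_{s,1}(t+h,t)=\exp(-\mathrm{i} f_2(t+h)H_2h)\exp(-\mathrm{i} f_1(t+h)H_1h)$; $U_{g,1}(t+h,t)=\exp(-\mathrm{i}\int_t^{t+h}f_2(s)ds\,H_2)\exp(-\mathrm{i}\int_t^{t+h}f_1(s)ds\,H_1)$; $U_{s,2}(t+h,t)=\exp(-\frac{\mathrm{i} h}{2}f_1(t+h/2)H_1)\exp(-\mathrm{i} hf_2(t+h/2)H_2)\exp(-\frac{\mathrm{i} h}{2}f_1(t+h/2)H_1)$; $U_{g,2}(t+h,t)=\exp(-\mathrm{i}\int_{t+h/2}^{t+h}f_1(s)ds\,H_1)\exp(-\mathrm{i}\int_t^{t+h}f_2(s)ds\,H_2)\exp(-\mathrm{i}\int_t^{t+h/2}f_1(s)ds\,H_1)$.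 *)

(* Defs.v *)
From HB Require Import structures.
From mathcomp Require Import all_boot all_order all_algebra.
From mathcomp Require Import all_classical all_reals all_analysis.
From mathcomp Require Import complex.
Set Implicit Arguments. Unset Strict Implicit. Unset Printing Implicit Defensive.
Import Order.TTheory GRing.Theory Num.Theory.
Import numFieldNormedType.Exports.
Local Open Scope classical_set_scope.
Local Open Scope ring_scope.

Definition reC {R : Type} (z : complex R) : R := complex.Re z.
Definition imC {R : Type} (z : complex R) : R := complex.Im z.

Definition cconj {R : realType} (z : complex R) : complex R :=
  complex.Complex (reC z) (- imC z).

Definition RtoC {R : realType} (x : R) : complex R := complex.Complex x 0.

Definition iC {R : realType} : complex R := complex.Complex 0 1.

Definition vnorm {R : realType} (n : nat) (v : 'cV[complex R]_n) : R :=
  Num.sqrt (\sum_(i < n) (reC (v i 0) ^+ 2 + imC (v i 0) ^+ 2)).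

Definition opnorm {R : realType} (n : nat) (A : 'M[complex R]_n) : R :=
  sup [set vnorm (A *m v) | v in [set v : 'cV[complex R]_n | vnorm v <= 1]].

Definition is_hermitian {R : realType} (n : nat) (A : 'M[complex R]_n) : Prop :=
  forall i j, A j i = cconj (A i j).

Definition mcomm {R : realType} (n : nat) (A B : 'M[complex R]_n)
  : 'M[complex R]_n := A *m B - B *m A.

Definition expm {R : realType} (n : nat) (A : 'M[complex R]_n)
  : 'M[complex R]_n :=
  lim (series (fun k : nat => (RtoC (k`!%:R)^-1) *: (A ^+ k)) @ \oo).

Definition supnorm {R : realType} (T : R) (f : R -> R) : R :=
  sup [set `|f t| | t in `[0, T]].

Definition integ {R : realType} (a b : R) (f : R -> R) : R :=
  (\int[lebesgue_measure]_(x in `[a, b]) f x)%R.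

Definition mx_has_deriv {R : realType} (n : nat)
  (F : R -> 'M[complex R]_n) (D : 'M[complex R]_n) (t : R) : Prop :=
  forall i j,
    is_derive t 1 (fun s => reC (F s i j)) (reC (D i j)) /\
    is_derive t 1 (fun s => imC (F s i j)) (imC (D i j)).

Definition mx_continuous_on {R : realType} (n : nat) (A : set R)
  (F : R -> 'M[complex R]_n) : Prop :=
  forall i j,
    {within A, continuous (fun s => reC (F s i j))} /\
    {within A, continuous (fun s => imC (F s i j))}.

(* f is C^2 on [0,T] with first and second derivatives df, ddf:
   derivatives in the interior, all three continuous on the closed interval
   (equivalently, one-sided derivatives at the endpoints). *)
Definition C2_on {R : realType} (T : R) (f df ddf : R -> R) : Prop :=
  (forall t, 0 < t < T -> is_derive t 1 f (df t) /\ is_derive t 1 df (ddf t)) /\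
  {within `[0, T], continuous f} /\
  {within `[0, T], continuous df} /\
  {within `[0, T], continuous ddf}.

(* Main.v *)
(** Write every Trotter step at time [t] as
    [V t = exp (- i a H1) exp (- i b H2) exp (- i c H1)] with scalar functions [a], [b],
    [c] vanishing at [0] ([a = 0] for the first-order steps). Since the exact evolution [U]
    is unitary, [V h - U h = U h (W h - 1)] with [W = U^* V], and [W' = - i U^* D V] where,
    after conjugation by [exp (- i a H1)], the generator error [D] becomes
    [(a' + c' - f1) H1 + (b' - f2) H2 + c' (X - H1) - f2 (Y - H2)] with
    [X = exp (- i b H2) H1 exp (i b H2)] and [Y = exp (i a H1) H2 exp (- i a H1)].
    Expanding [X] and [Y] to first or second order in [b] and [a] gives commutators; the
    first-order terms of [X] and [Y] combine into [i (c' b - f2 a) [H1, H2]], which is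
    small by Taylor's formula. The mean value inequality for [W] finishes the proof. *)

Require Import Defs.
From HB Require Import structures.
From mathcomp Require Import all_boot all_order all_algebra.
From mathcomp Require Import all_classical all_reals all_analysis.
From mathcomp Require Import complex ring lra.
Import Order.TTheory GRing.Theory Num.Theory.
Import numFieldNormedType.Exports.
Local Open Scope classical_set_scope.
Local Open Scope ring_scope.

Set Implicit Arguments.
Unset Strict Implicit.
Unset Printing Implicit Defensive.

(** In each step [h] is replaced throughout by a variable [t], so the evaluation points move with
    [t]. Differentiating [t * f1 t] or [t / 2 * f1 (t / 2)] is what brings [df1] and [df2] into the
    bounds for the standard steps. The derivative of the last scalar function is cut into three
    summands [p + q + r], because its parts have different sizes: in a second-order step a part of
    size 1 needs the second-order expansion of the conjugated [H1], while a part with a factor [t]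
    needs only the first-order one; in a first-order step everything is one order lower. A generator
    error of at most [k * t ^+ m] integrates to [k / m.+1%:R * h ^+ m.+1], the source of the factors
    1/2 and 1/3. The coefficients found in this way are at most the stated ones, which leaves a
    comparison of nonnegative terms. Matrix inequalities are tested on the real numbers
    [rdot w (X *m v)], so every mean value estimate reduces to the real mean value theorem. *)

Section LinearAlgebra.
Variable R : realType.
Local Notation C := (complex R).

(** * Complex scalars, adjoints, the real inner product and the operator norm *)

Lemma reCD (x y : C) : reC (x + y) = reC x + reC y.
Proof. by case: x y => [a b] [c d]. Qed.
Lemma imCD (x y : C) : imC (x + y) = imC x + imC y.
Proof. by case: x y => [a b] [c d]. Qed.
Lemma reCN (x : C) : reC (- x) = - reC x.
Proof. by case: x. Qed.
Lemma imCN (x : C) : imC (- x) = - imC x.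
Proof. by case: x. Qed.
Lemma reCM (x y : C) : reC (x * y) = reC x * reC y - imC x * imC y.
Proof. by case: x y => [a b] [c d]. Qed.
Lemma imCM (x y : C) : imC (x * y) = reC x * imC y + imC x * reC y.
Proof. by case: x y => [a b] [c d]. Qed.
Lemma reC_sum (I : Type) (r : seq I) (P : pred I) (F : I -> C) :
  reC (\sum_(i <- r | P i) F i) = \sum_(i <- r | P i) reC (F i).
Proof. by apply: (big_morph _ reCD). Qed.
Lemma imC_sum (I : Type) (r : seq I) (P : pred I) (F : I -> C) :
  imC (\sum_(i <- r | P i) F i) = \sum_(i <- r | P i) imC (F i).
Proof. by apply: (big_morph _ imCD). Qed.
Lemma complex_ext (x y : C) : reC x = reC y -> imC x = imC y -> x = y.
Proof. by case: x y => [a b] [c d] /= -> ->. Qed.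
Lemma RtoCD (x y : R) : RtoC (x + y) = RtoC x + RtoC y.
Proof. by apply: complex_ext; rewrite ?reCD ?imCD //= addr0. Qed.
Lemma RtoCM (x y : R) : RtoC (x * y) = RtoC x * RtoC y.
Proof. by apply: complex_ext; rewrite ?reCM ?imCM /= ?mulr0 ?mul0r ?subr0 ?addr0. Qed.
Lemma RtoCN (x : R) : RtoC (- x) = - RtoC x.
Proof. by apply: complex_ext; rewrite ?reCN ?imCN /= ?oppr0. Qed.
Lemma RtoCX (x : R) k : RtoC (x ^+ k) = RtoC x ^+ k.
Proof. by elim: k => [|k IH]; rewrite // !exprS RtoCM IH. Qed.
Lemma cconjM (x y : C) : cconj (x * y) = cconj x * cconj y.
Proof. by apply: complex_ext; rewrite ?(reCM, imCM) /= ?(reCM, imCM); ring. Qed.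
Lemma cconjD (x y : C) : cconj (x + y) = cconj x + cconj y.
Proof. by apply: complex_ext; rewrite ?(reCD, imCD) /= ?(reCD, imCD) //; ring. Qed.
Lemma cconj_sum (I : Type) (r : seq I) (P : pred I) (F : I -> C) :
  cconj (\sum_(i <- r | P i) F i) = \sum_(i <- r | P i) cconj (F i).
Proof. by apply: (big_morph _ cconjD); apply: complex_ext; rewrite /= ?oppr0. Qed.
Lemma cconjK (x : C) : cconj (cconj x) = x.
Proof. by apply: complex_ext; rewrite /= ?opprK. Qed.

Definition adjmx m n (A : 'M[C]_(m, n)) : 'M[C]_(n, m) :=
  \matrix_(i, j) cconj (A j i).

Lemma adjmxK m n (A : 'M[C]_(m, n)) : adjmx (adjmx A) = A.
Proof. by apply/matrixP => i j; rewrite !mxE cconjK. Qed.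
Lemma adjmxM m n p (A : 'M[C]_(m, n)) (B : 'M[C]_(n, p)) :
  adjmx (A *m B) = adjmx B *m adjmx A.
Proof.
apply/matrixP => i j; rewrite !mxE cconj_sum; apply: eq_bigr => k _.
by rewrite !mxE cconjM mulrC.
Qed.
Lemma adjmxZ m n z (A : 'M[C]_(m, n)) : adjmx (z *: A) = cconj z *: adjmx A.
Proof. by apply/matrixP => i j; rewrite !mxE cconjM. Qed.
Lemma adjmx1 n : adjmx (1%:M : 'M[C]_n) = 1%:M.
Proof.
apply/matrixP => i j; rewrite !mxE eq_sym; case: (_ == _) => /=;
by apply: complex_ext; rewrite /= ?oppr0.
Qed.
Lemma hermitian_adjmx n (A : 'M[C]_n) : is_hermitian A -> adjmx A = A.
Proof. by move=> hA; apply/matrixP => i j; rewrite !mxE -hA. Qed.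

(* The real part of the inner product already induces [vnorm]; the imaginary part
   is never needed. *)
Definition rdot n (w v : 'cV[C]_n) : R := reC ((adjmx w *m v) 0 0).

Lemma rdotE n (w v : 'cV[C]_n) :
  rdot w v = \sum_i (reC (w i 0) * reC (v i 0) + imC (w i 0) * imC (v i 0)).
Proof.
rewrite /rdot mxE reC_sum; apply: eq_bigr => i _.
by rewrite mxE reCM /= mulNr opprK.
Qed.
Lemma rdotC n (w v : 'cV[C]_n) : rdot w v = rdot v w.
Proof. by rewrite !rdotE; apply: eq_bigr => i _; ring. Qed.
Lemma rdotDr n (w u v : 'cV[C]_n) : rdot w (u + v) = rdot w u + rdot w v.
Proof. by rewrite /rdot mulmxDr mxE reCD. Qed.
Lemma rdotNr n (w v : 'cV[C]_n) : rdot w (- v) = - rdot w v.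
Proof. by rewrite /rdot mulmxN mxE reCN. Qed.
Lemma rdotZr n (w v : 'cV[C]_n) a : rdot w (RtoC a *: v) = a * rdot w v.
Proof. by rewrite /rdot -scalemxAr mxE reCM /= mul0r subr0. Qed.
Lemma rdot_adj m n (w : 'cV[C]_n) (A : 'M[C]_(n, m)) v :
  rdot w (A *m v) = rdot (adjmx A *m w) v.
Proof. by rewrite /rdot adjmxM adjmxK mulmxA. Qed.
Lemma rdot_ge0 n (v : 'cV[C]_n) : 0 <= rdot v v.
Proof. by rewrite rdotE; apply: sumr_ge0 => i _; rewrite addr_ge0 // -expr2 sqr_ge0. Qed.
Lemma rdot_eq0 n (v : 'cV[C]_n) : rdot v v = 0 -> v = 0.
Proof.
rewrite rdotE => /eqP; rewrite psumr_eq0; last first.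
  by move=> i _; rewrite addr_ge0 // -expr2 sqr_ge0.
move=> /allP v0; apply/matrixP => i j; rewrite ord1 [RHS]mxE.
have := v0 i (mem_index_enum _); rewrite /= -!expr2 paddr_eq0 ?sqr_ge0 //.
by rewrite !sqrf_eq0 => /andP[/eqP a0 /eqP b0]; apply: complex_ext.
Qed.

Lemma vnorm_rdot n (v : 'cV[C]_n) : vnorm v ^+ 2 = rdot v v.
Proof.
rewrite /vnorm sqr_sqrtr; last by apply: sumr_ge0 => i _; rewrite addr_ge0 ?sqr_ge0.
by rewrite rdotE; apply: eq_bigr => i _; rewrite !expr2.
Qed.
Lemma vnorm_ge0 n (v : 'cV[C]_n) : 0 <= vnorm v.
Proof. exact: sqrtr_ge0. Qed.
Lemma vnorm0 n : vnorm (0 : 'cV[C]_n) = 0.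
Proof. by apply/eqP; rewrite -sqrf_eq0 vnorm_rdot /rdot mulmx0 mxE. Qed.
Lemma vnorm_eq n m (v : 'cV[C]_n) (w : 'cV[C]_m) : rdot v v = rdot w w -> vnorm v = vnorm w.
Proof. by move=> e; apply/eqP; rewrite -(@eqrXn2 _ 2) ?vnorm_ge0 // !vnorm_rdot e. Qed.

Lemma rdot_CauchySchwarz n (w v : 'cV[C]_n) : `|rdot w v| <= vnorm w * vnorm v.
Proof.
rewrite -(@ler_pXn2r _ 2) ?nnegrE ?mulr_ge0 ?vnorm_ge0 // real_normK ?num_real //.
rewrite exprMn !vnorm_rdot; have [v0|vn0] := eqVneq (rdot v v) 0.
  by rewrite (rdot_eq0 v0) /rdot !mulmx0 !mxE expr0n mulr0.
have v_gt0 : 0 < rdot v v by rewrite lt_def vn0 rdot_ge0.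
(* The squared norm of this vector is [rdot v v] times [rdot v v * rdot w w - rdot w v ^+ 2], the
   difference to be shown nonnegative. *)
have := rdot_ge0 (RtoC (rdot v v) *: w - RtoC (rdot w v) *: v).
rewrite !rdotDr !rdotNr !rdotZr ![rdot (_ - _) _]rdotC.
rewrite !rdotDr !rdotNr !rdotZr (rdotC v w) => h.
rewrite -subr_ge0 -(pmulr_rge0 _ v_gt0); apply: le_trans h _.
by rewrite le_eqVlt; apply/orP; left; apply/eqP; ring.
Qed.

(** Testing with [w := v] suffices. This duality turns norm bounds into bounds on real numbers. *)
Lemma vnorm_le_rdot n (v : 'cV[C]_n) M : 0 <= M ->
  (forall w, rdot w v <= M * vnorm w) -> vnorm v <= M.
Proof.
move=> M0 hM; have [->//|vn0] := eqVneq (vnorm v) 0.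
have v_gt0 : 0 < vnorm v by rewrite lt_def vn0 vnorm_ge0.
by have := hM v; rewrite -vnorm_rdot expr2 ler_pM2r.
Qed.

Lemma vnormD n (u v : 'cV[C]_n) : vnorm (u + v) <= vnorm u + vnorm v.
Proof.
apply: vnorm_le_rdot => [|w]; first by rewrite addr_ge0 ?vnorm_ge0.
rewrite rdotDr mulrDl lerD // mulrC; apply: le_trans (ler_norm _) _;
exact: rdot_CauchySchwarz.
Qed.

Lemma vnormZ n (v : 'cV[C]_n) a : vnorm (RtoC a *: v) = `|a| * vnorm v.
Proof.
apply/eqP; rewrite -(@eqrXn2 _ 2) ?mulr_ge0 ?vnorm_ge0 // exprMn.
by rewrite real_normK ?num_real // !vnorm_rdot rdotZr rdotC rdotZr; apply/eqP; ring.
Qed.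

Lemma vnormZi n (v : 'cV[C]_n) : vnorm (iC *: v) = vnorm v.
Proof.
apply: vnorm_eq; rewrite !rdotE; apply: eq_bigr => i _.
by rewrite !mxE !reCM !imCM /=; ring.
Qed.

Lemma vnormN n (v : 'cV[C]_n) : vnorm (- v) = vnorm v.
Proof. by apply: vnorm_eq; rewrite rdotNr rdotC rdotNr opprK. Qed.

Lemma vnorm_sum n (I : Type) (r : seq I) (F : I -> 'cV[C]_n) :
  vnorm (\sum_(i <- r) F i) <= \sum_(i <- r) vnorm (F i).
Proof.
elim: r => [|i r IH]; first by rewrite !big_nil vnorm0.
by rewrite !big_cons (le_trans (vnormD _ _)) // lerD2l.
Qed.

Lemma coord_le_vnorm n (v : 'cV[C]_n) i :
  `|reC (v i 0)| <= vnorm v /\ `|imC (v i 0)| <= vnorm v.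
Proof.
have le : reC (v i 0) ^+ 2 + imC (v i 0) ^+ 2 <= vnorm v ^+ 2.
  rewrite vnorm_rdot rdotE (bigD1 i) //= -!expr2 lerDl; apply: sumr_ge0 => j _.
  by rewrite addr_ge0 // -expr2 sqr_ge0.
split; rewrite -(@ler_pXn2r _ 2) ?nnegrE ?vnorm_ge0 // real_normK ?num_real //;
apply: le_trans le; by rewrite ?lerDl ?lerDr sqr_ge0.
Qed.

Lemma mulmx_bounded n (A : 'M[C]_n) :
  exists2 M, 0 <= M & forall v, vnorm (A *m v) <= M * vnorm v.
Proof.
exists (\sum_j (vnorm (col j A) + vnorm (col j A))).
  by apply: sumr_ge0 => j _; rewrite addr_ge0 ?vnorm_ge0.
(* [vnormZ] concerns real scalars, so each coordinate is split into its two parts; [iC] preserves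
   the norm, hence each column counts twice in the bound. *)
move=> v; have -> : A *m v =
   \sum_j (RtoC (reC (v j 0)) *: col j A + RtoC (imC (v j 0)) *: (iC *: col j A)).
  apply/matrixP => i k; rewrite ord1 summxE mxE; apply: eq_bigr => j _.
  rewrite !mxE; apply: complex_ext; rewrite !(reCD, imCD, reCM, imCM) /=; ring.
rewrite (le_trans (vnorm_sum _ _)) // mulr_suml; apply: ler_sum => j _.
rewrite (le_trans (vnormD _ _)) // !vnormZ vnormZi [leRHS]mulrDl.
have [le1 le2] := coord_le_vnorm v j.
by rewrite lerD // [leRHS]mulrC ler_wpM2r ?vnorm_ge0.
Qed.

(** [sup] is a least upper bound only for a nonempty bounded set; this is what gives [opnorm] its
    meaning. *)
Lemma opnorm_has_sup n (A : 'M[C]_n) :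
  has_sup [set vnorm (A *m v) | v in [set v : 'cV[C]_n | vnorm v <= 1]].
Proof.
split; first by exists (vnorm (A *m 0)), 0; rewrite //= vnorm0.
have [M M0 hM] := mulmx_bounded A; exists M => _ [v /= v1 <-].
by rewrite (le_trans (hM v)) // ler_piMr.
Qed.

Lemma opnorm_ge0 n (A : 'M[C]_n) : 0 <= opnorm A.
Proof.
have <- : vnorm (A *m 0) = 0 by rewrite mulmx0 vnorm0.
apply: ub_le_sup; first by case: (opnorm_has_sup A).
by exists 0; rewrite //= vnorm0.
Qed.

Lemma vnorm_mulmx n (A : 'M[C]_n) v : vnorm (A *m v) <= opnorm A * vnorm v.
Proof.
have [v0|vn0] := eqVneq (vnorm v) 0.
  have -> : v = 0 by apply: rdot_eq0; rewrite -vnorm_rdot v0 expr0n.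
  by rewrite mulmx0 vnorm0 mulr0.
have v_gt0 : 0 < vnorm v by rewrite lt_def vn0 vnorm_ge0.
have -> : vnorm (A *m v) = vnorm (A *m (RtoC (vnorm v)^-1 *: v)) * vnorm v.
  by rewrite -scalemxAr vnormZ ger0_norm ?invr_ge0 ?vnorm_ge0 // mulrAC mulVf // mul1r.
rewrite ler_pM2r //; apply: ub_le_sup; first by case: (opnorm_has_sup A).
exists (RtoC (vnorm v)^-1 *: v) => //=.
by rewrite vnormZ ger0_norm ?invr_ge0 ?vnorm_ge0 // mulVf.
Qed.

Lemma opnorm_le n (A : 'M[C]_n) M : 0 <= M ->
  (forall v, vnorm (A *m v) <= M * vnorm v) -> opnorm A <= M.
Proof.
move=> M0 hM; apply: ge_sup; first by case: (opnorm_has_sup A).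
by move=> _ [v /= v1 <-]; rewrite (le_trans (hM v)) // ler_piMr.
Qed.

Lemma rdot_opnorm n (A : 'M[C]_n) w v :
  `|rdot w (A *m v)| <= opnorm A * (vnorm w * vnorm v).
Proof.
rewrite (le_trans (rdot_CauchySchwarz _ _)) // mulrCA ler_wpM2l ?vnorm_ge0 //.
exact: vnorm_mulmx.
Qed.

(** In this form a bound on the operator norm is a family of scalar bounds, real-linear in [A], to
    which real calculus applies. *)
Lemma opnorm_le_rdot n (A : 'M[C]_n) M : 0 <= M ->
  (forall w v, rdot w (A *m v) <= M * (vnorm w * vnorm v)) -> opnorm A <= M.
Proof.
move=> M0 hM; apply: opnorm_le => // v; apply: vnorm_le_rdot.
  by rewrite mulr_ge0 ?vnorm_ge0.
by move=> w; rewrite -mulrA [vnorm v * _]mulrC.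
Qed.

Lemma opnormD n (A B : 'M[C]_n) : opnorm (A + B) <= opnorm A + opnorm B.
Proof.
apply: opnorm_le => [|v]; first by rewrite addr_ge0 ?opnorm_ge0.
by rewrite mulmxDl (le_trans (vnormD _ _)) // mulrDl lerD ?vnorm_mulmx.
Qed.

Lemma opnormZ n (A : 'M[C]_n) a : opnorm (RtoC a *: A) <= `|a| * opnorm A.
Proof.
apply: opnorm_le => [|v]; first by rewrite mulr_ge0 ?opnorm_ge0.
by rewrite -scalemxAl vnormZ -mulrA ler_wpM2l ?vnorm_mulmx.
Qed.

Lemma opnormZi n (A : 'M[C]_n) : opnorm (iC *: A) <= opnorm A.
Proof.
apply: opnorm_le => [|v]; first exact: opnorm_ge0.
by rewrite -scalemxAl vnormZi vnorm_mulmx.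
Qed.

Lemma opnormN n (A : 'M[C]_n) : opnorm (- A) = opnorm A.
Proof.
have le B : opnorm (- B) <= opnorm B :> R.
  apply: opnorm_le => [|v]; first exact: opnorm_ge0.
  by rewrite mulNmx vnormN vnorm_mulmx.
by apply/eqP; rewrite eq_le le -{1}(opprK A) le.
Qed.

Definition unitary n (Q : 'M[C]_n) := adjmx Q *m Q = 1%:M.

Lemma unitaryV n (Q : 'M[C]_n) : unitary Q -> Q *m adjmx Q = 1%:M.
Proof. exact: mulmx1C. Qed.

Lemma unitary_adj n (Q : 'M[C]_n) : unitary Q -> unitary (adjmx Q).
Proof. by rewrite /unitary adjmxK => /unitaryV. Qed.

Lemma unitaryM n (P Q : 'M[C]_n) : unitary P -> unitary Q -> unitary (P *m Q).
Proof. by move=> uP uQ; rewrite /unitary adjmxM mulmxA -(mulmxA _ _ P) uP mulmx1. Qed.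

Lemma vnorm_unitary n (Q : 'M[C]_n) v : unitary Q -> vnorm (Q *m v) = vnorm v.
Proof. by move=> uQ; apply: vnorm_eq; rewrite rdot_adj mulmxA uQ mul1mx. Qed.

Lemma opnorm_conj n (Q A : 'M[C]_n) : unitary Q ->
  opnorm (Q *m A *m adjmx Q) <= opnorm A.
Proof.
move=> uQ; apply: opnorm_le => [|v]; first exact: opnorm_ge0.
rewrite -!mulmxA vnorm_unitary // (le_trans (vnorm_mulmx _ _)) //.
by rewrite vnorm_unitary //; exact: unitary_adj.
Qed.

End LinearAlgebra.

(** * Derivatives and continuity of real and matrix functions *)

Section Calculus.
Variable R : realType.
Local Notation C := (complex R).

Section RealFunctions.
Implicit Types (f g : R -> R) (A : set R) (x df dg : R).

Lemma is_derive_add f g x df dg : is_derive x 1 f df -> is_derive x 1 g dg ->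
  is_derive x 1 (fun s => f s + g s) (df + dg).
Proof. by move=> hf hg; exact: is_deriveD. Qed.
Lemma is_derive_congr f x df dg : is_derive x 1 f df -> df = dg -> is_derive x 1 f dg.
Proof. by move=> hf <-. Qed.
Lemma is_derive_opp f x df : is_derive x 1 f df ->
  is_derive x 1 (fun s => - f s) (- df).
Proof. by move=> hf; exact: is_deriveN. Qed.
Lemma is_derive_mul f g x df dg : is_derive x 1 f df -> is_derive x 1 g dg ->
  is_derive x 1 (fun s => f s * g s) (df * g x + f x * dg).
Proof.
move=> hf hg; have := @is_deriveM R R f g x 1 df dg hf hg.
by rewrite addrC /GRing.scale /= [g x * _]mulrC.
Qed.
Lemma is_derive_const x (k : R) : is_derive x 1 (fun _ : R => k) (0 : R).
Proof. exact: is_derive_cst. Qed.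
Lemma is_derive_pow x m : is_derive x 1 (fun s : R => s ^+ m.+1) (m.+1%:R * x ^+ m).
Proof.
elim: m => [|m IH].
  by under eq_fun do rewrite expr1; rewrite expr0 mulr1; exact: is_derive_id.
under eq_fun do rewrite exprS.
have := is_derive_mul (is_derive_id x 1) IH; congr (is_derive _ _ _ _).
by rewrite -[m.+2%:R]natr1 !exprS; ring.
Qed.
Lemma is_derive_sumf (I : Type) (r : seq I) (h : I -> R -> R) (dh : I -> R) x :
  (forall i, is_derive x 1 (h i) (dh i)) ->
  is_derive x 1 (fun s => \sum_(i <- r) h i s) (\sum_(i <- r) dh i).
Proof.
move=> hh; elim: r => [|i r IH].
  rewrite big_nil; under eq_fun do rewrite big_nil; exact: is_derive_const.
rewrite big_cons; under eq_fun do rewrite big_cons; exact: is_derive_add.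
Qed.

Lemma within_add A f g : {within A, continuous f} -> {within A, continuous g} ->
  {within A, continuous (fun s => f s + g s)}.
Proof. by move=> cf cg x; apply: continuousD; [exact: cf|exact: cg]. Qed.
Lemma within_opp A f : {within A, continuous f} ->
  {within A, continuous (fun s => - f s)}.
Proof. by move=> cf x; apply: continuousN; exact: cf. Qed.
Lemma within_mul A f g : {within A, continuous f} -> {within A, continuous g} ->
  {within A, continuous (fun s => f s * g s)}.
Proof. by move=> cf cg x; apply: continuousM; [exact: cf|exact: cg]. Qed.
Lemma within_const A (k : R) : {within A, continuous (fun _ : R => k)}.
Proof. by move=> x; exact: cst_continuous. Qed.
Lemma within_sum A (I : Type) (r : seq I) (h : I -> R -> R) :
  (forall i, {within A, continuous (h i)}) ->
  {within A, continuous (fun s => \sum_(i <- r) h i s)}.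
Proof.
move=> hh; elim: r => [|i r IH].
  by under eq_fun do rewrite big_nil; exact: within_const.
by under eq_fun do rewrite big_cons; exact: within_add.
Qed.
Lemma within_comp A f g : {within A, continuous f} -> continuous g ->
  {within A, continuous (fun s => g (f s))}.
Proof. by move=> cf cg x; apply: continuous_comp; [exact: cf|exact: cg]. Qed.

(** Serves [t |-> f (t / 2)], where [f] is continuous only within [[0, T]] and [t / 2] stays in that
    interval. *)
Lemma within_comp_within A B f g : {within B, continuous g} ->
  (forall x, A x -> B (f x)) -> continuous f -> {within A, continuous (fun s => g (f s))}.
Proof.
move=> cg AB cf; apply/subspace_continuousP => x Ax.
have cgx := (subspace_continuousP _ _).1 cg (f x) (AB x Ax).
move=> W /cgx BW; have Wx : \forall y \near x, B (f y) -> W (g (f y)) := cf x _ BW.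
rewrite /= /within /=; apply: filterS Wx => y hy Ay; exact: hy (AB y Ay).
Qed.

Lemma is_derive_within A f (df : R -> R) : (forall x, is_derive x 1 f (df x)) ->
  {within A, continuous f}.
Proof.
move=> hf; apply: continuous_subspaceT => x.
by apply: differentiable_continuous; apply/derivable1_diffP; case: (hf x).
Qed.

(** The mean value theorem for [g - f], whose derivative is nonnegative. Interior derivatives and
    continuity up to the endpoints match the data in [C2_on]. *)
Lemma derive_le_le f g (df dg : R -> R) (a b : R) : a <= b ->
  (forall t, a < t < b -> is_derive t 1 f (df t)) ->
  (forall t, a < t < b -> is_derive t 1 g (dg t)) ->
  {within `[a, b], continuous f} -> {within `[a, b], continuous g} ->
  (forall t, a < t < b -> df t <= dg t) -> f b - f a <= g b - g a.
Proof.
move=> ab hf hg cf cg le; rewrite le_eqVlt in ab.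
case/orP: ab => [/eqP <-|ab]; first by rewrite !subrr.
have [c] := @MVT R (fun t => g t + - f t) (fun t => dg t + - df t) a b ab
  (fun t tin => is_derive_add (hg t tin) (is_derive_opp (hf t tin)))
  (within_add cg (within_opp cf)).
rewrite in_itv /= => cin e.
have := mulr_ge0 (_ : 0 <= dg c - df c) (_ : 0 <= b - a); rewrite -e.
rewrite !subr_ge0 => /(_ (le c cin) (ltW ab)); lra.
Qed.

Lemma norm_derive_le f g (df dg : R -> R) (a b : R) : a <= b ->
  (forall t, a < t < b -> is_derive t 1 f (df t)) ->
  (forall t, a < t < b -> is_derive t 1 g (dg t)) ->
  {within `[a, b], continuous f} -> {within `[a, b], continuous g} ->
  (forall t, a < t < b -> `|df t| <= dg t) -> `|f b - f a| <= g b - g a.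
Proof.
move=> ab hf hg cf cg le; rewrite ler_norml lerNl; apply/andP; split.
  have := @derive_le_le (fun t => - f t) g (fun t => - df t) dg a b ab
    (fun t tin => is_derive_opp (hf t tin)) hg (within_opp cf) cg.
  rewrite -opprD; apply => t /le; rewrite -normrN; exact: le_trans (ler_norm _).
by apply: derive_le_le hf hg cf cg _ => // t /le; exact: le_trans (ler_norm _).
Qed.

End RealFunctions.

Section MatrixFunctions.
Variable n : nat.
Implicit Types (F G : R -> 'M[C]_n) (D : 'M[C]_n) (A : set R) (t df : R).

Lemma mx_has_derivM F G DF DG t : mx_has_deriv F DF t -> mx_has_deriv G DG t ->
  mx_has_deriv (fun s => F s *m G s) (DF *m G t + F t *m DG) t.
Proof.
move=> hF hG i j; rewrite mxE !mxE -big_split /=.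
split; [rewrite reC_sum|rewrite imC_sum].
- under eq_fun do rewrite mxE reC_sum.
  apply: is_derive_sumf => k; have [f1 f2] := hF i k; have [g1 g2] := hG k j.
  under eq_fun do rewrite reCM; rewrite reCD !reCM.
  by apply: is_derive_congr; rewrite /GRing.scale /=; ring.
- under eq_fun do rewrite mxE imC_sum.
  apply: is_derive_sumf => k; have [f1 f2] := hF i k; have [g1 g2] := hG k j.
  under eq_fun do rewrite imCM; rewrite imCD !imCM.
  by apply: is_derive_congr; rewrite /GRing.scale /=; ring.
Qed.

Lemma mx_has_derivD F G DF DG t : mx_has_deriv F DF t -> mx_has_deriv G DG t ->
  mx_has_deriv (fun s => F s + G s) (DF + DG) t.
Proof.
move=> hF hG i j; have [f1 f2] := hF i j; have [g1 g2] := hG i j.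
rewrite !mxE reCD imCD; split.
  by under eq_fun do rewrite mxE reCD; exact: is_derive_add.
by under eq_fun do rewrite mxE imCD; exact: is_derive_add.
Qed.

Lemma mx_has_deriv_cst D t : mx_has_deriv (fun=> D) 0 t.
Proof. by move=> i j; rewrite mxE; split; exact: is_derive_const. Qed.

Lemma mx_has_derivZ (f : R -> R) df D t : is_derive t 1 f df ->
  mx_has_deriv (fun s => RtoC (f s) *: D) (RtoC df *: D) t.
Proof.
move=> hf i j; rewrite !mxE reCM imCM /= !mul0r subr0 addr0.
have e k : is_derive t 1 (fun s => f s * k) (df * k).
  by apply: is_derive_congr; rewrite /GRing.scale /=; ring.
split; [under eq_fun do rewrite mxE reCM /= mul0r subr0; exact: e
       |under eq_fun do rewrite mxE imCM /= mul0r addr0; exact: e].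
Qed.

Lemma mx_has_deriv_adj F D t : mx_has_deriv F D t ->
  mx_has_deriv (fun s => adjmx (F s)) (adjmx D) t.
Proof.
move=> hF i j; have [f1 f2] := hF j i; rewrite !mxE /=.
split; under eq_fun do rewrite mxE /=; first by [].
exact: is_derive_opp.
Qed.

Lemma mx_has_deriv_comp F D (f : R -> R) df t : mx_has_deriv F D (f t) ->
  is_derive t 1 f df -> mx_has_deriv (fun s => F (f s)) (RtoC df *: D) t.
Proof.
move=> hF hf i j; have [f1 f2] := hF i j.
rewrite !mxE reCM imCM /= !mul0r subr0 addr0 !(mulrC df).
by split; [exact: (@is_derive1_comp _ (fun s => reC (F s i j)) f)
          |exact: (@is_derive1_comp _ (fun s => imC (F s i j)) f)].
Qed.

(** A real-linear combination of the real and imaginary parts of the entries of [X]: derivatives and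
    continuity pass through it entry by entry. *)
Lemma rdot_mulmxE (w v : 'cV[C]_n) (X : 'M[C]_n) : rdot w (X *m v) =
  \sum_i (\sum_j (reC (w i 0) * (reC (X i j) * reC (v j 0) - imC (X i j) * imC (v j 0))
   + imC (w i 0) * (reC (X i j) * imC (v j 0) + imC (X i j) * reC (v j 0)))).
Proof.
rewrite rdotE; apply: eq_bigr => i _; rewrite mxE reC_sum imC_sum !mulr_sumr.
by rewrite -big_split; apply: eq_bigr => j _; rewrite reCM imCM.
Qed.

Lemma is_derive_rdot F D t w v : mx_has_deriv F D t ->
  is_derive t 1 (fun s => rdot w (F s *m v)) (rdot w (D *m v)).
Proof.
move=> hF; under eq_fun do rewrite rdot_mulmxE; rewrite rdot_mulmxE.
apply: is_derive_sumf => i; apply: is_derive_sumf => j; have [f1 f2] := hF i j.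
by apply: is_derive_congr; rewrite /GRing.scale /=; ring.
Qed.

Lemma mx_continuous_onM A F G : mx_continuous_on A F -> mx_continuous_on A G ->
  mx_continuous_on A (fun s => F s *m G s).
Proof.
move=> hF hG i j; split.
- under eq_fun do rewrite mxE reC_sum.
  apply: within_sum => k; have [f1 f2] := hF i k; have [g1 g2] := hG k j.
  under eq_fun do rewrite reCM.
  by apply: within_add; [|apply: within_opp]; exact: within_mul.
- under eq_fun do rewrite mxE imC_sum.
  apply: within_sum => k; have [f1 f2] := hF i k; have [g1 g2] := hG k j.
  under eq_fun do rewrite imCM.
  by apply: within_add; exact: within_mul.
Qed.

Lemma mx_continuous_on_adj A F : mx_continuous_on A F ->
  mx_continuous_on A (fun s => adjmx (F s)).
Proof.
move=> hF i j; have [f1 f2] := hF j i.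
split; under eq_fun do rewrite mxE /=; first by [].
exact: within_opp.
Qed.

Lemma mx_continuous_on_comp A F dF (f : R -> R) :
  (forall s, mx_has_deriv F (dF s) s) -> {within A, continuous f} ->
  mx_continuous_on A (fun s => F (f s)).
Proof.
move=> hF cf i j.
split; [apply: (@within_comp A f (fun s => reC (F s i j))) => // x
       |apply: (@within_comp A f (fun s => imC (F s i j))) => // x];
by apply: differentiable_continuous; apply/derivable1_diffP;
   have [[? _] [? _]] := hF x i j.
Qed.

Lemma within_rdot A F w v : mx_continuous_on A F ->
  {within A, continuous (fun s => rdot w (F s *m v))}.
Proof.
move=> hF; under eq_fun do rewrite rdot_mulmxE.
apply: within_sum => i; apply: within_sum => j; have [f1 f2] := hF i j.
apply: within_add; apply: within_mul; try exact: within_const.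
  apply: within_add; last apply: within_opp;
  by apply: within_mul => //; exact: within_const.
by apply: within_add; apply: within_mul => //; exact: within_const.
Qed.

Lemma mx_continuous_onW A B F : A `<=` B -> mx_continuous_on B F ->
  mx_continuous_on A F.
Proof.
move=> AB hF i j; have [f1 f2] := hF i j.
by split; exact: (continuous_subspaceW AB).
Qed.

End MatrixFunctions.
End Calculus.

(** * The exponential series and its derivative *)

Section ExponentialSeries.
Variable R : realType.
Implicit Types (u : nat -> R) (x : R).

(** Comparison with [K] times the exponential series at [|M * x|]. *)
Lemma cvg_exp_pseries u (K M x : R) : (forall k, `|u k| <= K * M ^+ k) ->
  cvgn (pseries (fun k => k`!%:R^-1 * u k) x).
Proof.
move=> hu; have K0 : 0 <= K by have := hu 0%N; rewrite expr0 mulr1; exact: le_trans.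
apply: normed_cvg; rewrite /normed_series_of /=.
apply: (@series_le_cvg _ _ (fun k => K * exp_coeff `|M * x| k)) => //= [k|k|].
- by rewrite mulr_ge0 // exp_coeff_ge0.
- rewrite /exp_coeff /= !normrM normfV [`|_%:R|]ger0_norm // normrX exprMn.
  have -> : K * (`|M| ^+ k * `|x| ^+ k / k`!%:R) =
    k`!%:R^-1 * (K * `|M| ^+ k) * `|x| ^+ k by ring.
  rewrite ler_wpM2r ?exprn_ge0 // ler_wpM2l ?invr_ge0 //.
  by rewrite (le_trans (hu k)) // ler_wpM2l // -normrX ler_norm.
- apply: is_cvg_seriesZ; exact: is_cvg_series_exp_coeff.
Qed.

(** Since [(k + 1) / (k + 1)! = 1 / k!], termwise differentiation only shifts [u], and the shifted
    sequence has the same kind of bound with [K * M] in place of [K]. *)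
Lemma is_derive_exp_pseries u (K M x : R) : (forall k, `|u k| <= K * M ^+ k) ->
  is_derive x 1 (fun x => limn (pseries (fun k => k`!%:R^-1 * u k) x))
    (limn (pseries (fun k => k`!%:R^-1 * u k.+1) x)).
Proof.
have diffsE v : pseries_diffs (fun k => k`!%:R^-1 * v k) = fun k => k`!%:R^-1 * v k.+1 :> R.
  apply/funext => k; rewrite /pseries_diffs factS natrM invfM mulrA mulrA mulrV ?mul1r //.
  by rewrite unitfE pnatr_eq0.
have shift (v : nat -> R) L : (forall k, `|v k| <= L * M ^+ k) ->
    forall k, `|v k.+1| <= (L * M) * M ^+ k.
  by move=> hv k; rewrite -mulrA -exprS.
move=> hu; rewrite -diffsE.
(* The series and its first two formal derivatives must converge at a point beyond [x]; [|x| + 1] is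
   such a point. *)
apply: (@pseries_snd_diffs _ _ (`|x| + 1)).
- exact: cvg_exp_pseries hu.
- by rewrite diffsE; exact: (cvg_exp_pseries (shift u K hu)).
- rewrite !diffsE.
  exact: (cvg_exp_pseries (shift (fun k => u k.+1) _ (shift u K hu))).
- by rewrite [ltRHS]ger0_norm ?addr_ge0 // ltrDl.
Qed.

Lemma cvg_sumr (I : Type) (r : seq I) (f : I -> nat -> R) (l : I -> R) :
  (forall i, f i k @[k --> \oo] --> l i) ->
  (fun k => \sum_(i <- r) f i k) @ \oo --> \sum_(i <- r) l i.
Proof.
move=> hf; elim: r => [|i r IH].
  by rewrite big_nil; under eq_fun do rewrite big_nil; exact: cvg_cst.
by rewrite big_cons; under eq_fun do rewrite big_cons; exact: cvgD.
Qed.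

Local Notation C := (complex R).
Lemma normc_lt (z : C) (e : C) : 0 < e ->
  `|reC z| < reC e / 2 -> `|imC z| < reC e / 2 -> `|z| < e.
Proof.
case: z e => [a b] [e e'] /=; rewrite ltcE /= => /andP[/eqP -> e0] ha hb.
rewrite ltcE /= eqxx /= -(ger0_norm (ltW e0)) -sqrtr_sqr ltr_sqrt ?exprn_gt0 //.
have := exprn_ge0 2 (normr_ge0 a); have := exprn_ge0 2 (normr_ge0 b).
rewrite -(real_normK (num_real a)) -(real_normK (num_real b)).
move: (normr_ge0 a) (normr_ge0 b) ha hb => *; nra.
Qed.

Variable n : nat.
Implicit Type X : 'M[C]_n.

(** Matrix balls are entrywise, and bounds by [reC e / 2] on both parts of an entry bound its
    modulus by [e]. Convergence is thereby reduced to real sequences. *)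
Lemma cvg_matrix_reim (S : nat -> 'M[C]_n) (L : 'M[C : numFieldType]_n) :
  (forall i j, (fun k => reC (S k i j)) @ \oo --> reC (L i j)) ->
  (forall i j, (fun k => imC (S k i j)) @ \oo --> imC (L i j)) ->
  S @ \oo --> L.
Proof.
move=> hre him; pose K : numFieldType := C.
apply/(@cvg_ballP _ ('M[K]_n : pseudoMetricType K)) => e e0.
have e2 : 0 < reC e / 2.
  move: e0; case: e => [e e'] /=; rewrite ltcE /= => /andP[_ ?].
  by rewrite divr_gt0.
have near_ij : \forall k \near \oo, forall i j,
   `|reC (L i j) - reC (S k i j)| < reC e / 2 /\ `|imC (L i j) - imC (S k i j)| < reC e / 2.
  apply: filter_forall => i; apply: filter_forall => j.
  by apply: filterI; [move/cvgrPdist_lt: (hre i j)|move/cvgrPdist_lt: (him i j)]; apply.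
apply: filterS near_ij => k hk; split => // i j.
rewrite -ball_normE /=; have [h1 h2] := hk i j.
by apply: normc_lt => //; rewrite ?reCD ?reCN ?imCD ?imCN.
Qed.

(** The [j]-th column of [X ^+ k] is [X] applied [k] times to a basis vector, and each application
    multiplies the norm by at most [M]. *)
Lemma expr_entry_bounded X : exists M, forall i j k,
  `|reC ((X ^+ k) i j)| <= vnorm (col j (1 : 'M[C]_n)) * M ^+ k /\
  `|imC ((X ^+ k) i j)| <= vnorm (col j (1 : 'M[C]_n)) * M ^+ k.
Proof.
have [M M0 hM] := mulmx_bounded X; exists M => i j k.
suff le : vnorm (col j (X ^+ k)) <= vnorm (col j (1 : 'M[C]_n)) * M ^+ k.
  have [h1 h2] := coord_le_vnorm (col j (X ^+ k)) i.
  by move: h1 h2; rewrite !mxE => h1 h2; split; apply: le_trans le.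
elim: k => [|k IH]; first by rewrite !expr0 mulr1.
rewrite exprS colE -[X * _]/(X *m _) -mulmxA -colE (le_trans (hM _)) //.
by rewrite exprS mulrCA ler_wpM2l.
Qed.

Lemma exprmxZ X a k : (a *: X) ^+ k = a ^+ k *: X ^+ k.
Proof.
elim: k => [|k IH]; first by rewrite !expr0 scale1r.
have mE (A B : 'M[C]_n) : A * B = A *m B by [].
by rewrite exprS IH mE -scalemxAl -scalemxAr scalerA -mE -!exprS.
Qed.

(** An entry of [exp (s X)] as a pair of real power series in [s], ready for termwise
    differentiation. *)
Definition exp_entry X i j s : C := complex.Complex
  (limn (pseries (fun k => k`!%:R^-1 * reC ((X ^+ k) i j)) s))
  (limn (pseries (fun k => k`!%:R^-1 * imC ((X ^+ k) i j)) s)).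

Lemma expm_entry X s i j : expm (RtoC s *: X) i j = exp_entry X i j s.
Proof.
suff -> : expm (RtoC s *: X) = \matrix_(i, j) exp_entry X i j s by rewrite mxE.
have [M hM] := expr_entry_bounded X.
have termE (k : nat) i' j' : (RtoC k`!%:R^-1 *: (RtoC s *: X) ^+ k) i' j' =
    RtoC (k`!%:R^-1 * s ^+ k) * (X ^+ k) i' j'.
  by rewrite exprmxZ !mxE mulrA RtoCM RtoCX.
rewrite /expm.
apply: (@cvg_lim ('M[C : numFieldType]_n : normedModType (C : numFieldType))).
  exact: norm_hausdorff.
apply: cvg_matrix_reim => i' j'; rewrite mxE /=.
- under eq_fun => k do rewrite /series /= summxE reC_sum.
  have -> : (fun k => \sum_(0 <= l < k) reC ((RtoC l`!%:R^-1 *: (RtoC s *: X) ^+ l) i' j'))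
    = pseries (fun k => k`!%:R^-1 * reC ((X ^+ k) i' j')) s.
    apply/funext => k; apply: eq_bigr => l _; rewrite termE reCM /=; ring.
  exact: (@cvg_exp_pseries _ _ M s (fun k => (hM i' j' k).1)).
- under eq_fun => k do rewrite /series /= summxE imC_sum.
  have -> : (fun k => \sum_(0 <= l < k) imC ((RtoC l`!%:R^-1 *: (RtoC s *: X) ^+ l) i' j'))
    = pseries (fun k => k`!%:R^-1 * imC ((X ^+ k) i' j')) s.
    apply/funext => k; apply: eq_bigr => l _; rewrite termE imCM /=; ring.
  exact: (@cvg_exp_pseries _ _ M s (fun k => (hM i' j' k).2)).
Qed.
(** Differentiation replaces [X ^+ k] by [X ^+ k.+1], which is [X *m X ^+ k]; the finite sum in this
    product is then moved out of the limit. *)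
Lemma mx_has_deriv_expm X t :
  mx_has_deriv (fun s => expm (RtoC s *: X)) (X *m expm (RtoC t *: X)) t.
Proof.
have [M hM] := expr_entry_bounded X.
have cre i j : cvgn (pseries (fun k => k`!%:R^-1 * reC ((X ^+ k) i j)) t).
  exact: (@cvg_exp_pseries _ _ M t (fun k => (hM i j k).1)).
have cim i j : cvgn (pseries (fun k => k`!%:R^-1 * imC ((X ^+ k) i j)) t).
  exact: (@cvg_exp_pseries _ _ M t (fun k => (hM i j k).2)).
have XE k i j : (X ^+ k.+1) i j = \sum_l X i l * (X ^+ k) l j.
  by rewrite exprS -[X * _]/(X *m _) mxE.
(* Two families at once: the real and the imaginary part of a complex product both have the form
   [a * r1 + b * r2]. *)
have sumlim (u : nat -> R) (a b : 'I_n -> R) (r1 r2 : 'I_n -> nat -> R) :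
    (forall k, u k = \sum_l (a l * r1 l k + b l * r2 l k)) ->
    (forall l, cvgn (pseries (fun k => k`!%:R^-1 * r1 l k) t)) ->
    (forall l, cvgn (pseries (fun k => k`!%:R^-1 * r2 l k) t)) ->
    limn (pseries (fun k => k`!%:R^-1 * u k) t) = \sum_l
     (a l * limn (pseries (fun k => k`!%:R^-1 * r1 l k) t) +
      b l * limn (pseries (fun k => k`!%:R^-1 * r2 l k) t)).
  move=> uE c1 c2; apply/cvg_lim => //.
  have -> : pseries (fun k => k`!%:R^-1 * u k) t = fun N => \sum_l
     (a l * pseries (fun k => k`!%:R^-1 * r1 l k) t N +
      b l * pseries (fun k => k`!%:R^-1 * r2 l k) t N).
    apply/funext => N; rewrite /pseries /series /=.
    under [RHS]eq_bigr do rewrite !mulr_sumr -big_split /=.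
    rewrite exchange_big /=; apply: eq_bigr => k _.
    by rewrite uE mulr_sumr mulr_suml; apply: eq_bigr => l _; ring.
  apply: cvg_sumr => l; apply: cvgD; apply: cvgMr; [exact: c1|exact: c2].
move=> i j; rewrite mxE; split.
- under eq_fun do rewrite expm_entry /=.
  apply: is_derive_congr; first exact: (@is_derive_exp_pseries _ _ M _ (fun k => (hM i j k).1)).
  rewrite reC_sum (sumlim _ (fun l => reC (X i l)) (fun l => - imC (X i l))
    (fun l k => reC ((X ^+ k) l j)) (fun l k => imC ((X ^+ k) l j))) //.
    by apply: eq_bigr => l _; rewrite expm_entry reCM /= mulNr.
  by move=> k; rewrite XE reC_sum; apply: eq_bigr => l _; rewrite reCM mulNr.
- under eq_fun do rewrite expm_entry /=.
  apply: is_derive_congr; first exact: (@is_derive_exp_pseries _ _ M _ (fun k => (hM i j k).2)).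
  rewrite imC_sum (sumlim _ (fun l => reC (X i l)) (fun l => imC (X i l))
    (fun l k => imC ((X ^+ k) l j)) (fun l k => reC ((X ^+ k) l j))) //.
    by apply: eq_bigr => l _; rewrite expm_entry imCM.
  by move=> k; rewrite XE imC_sum; apply: eq_bigr => l _; rewrite imCM.
Qed.

Lemma pseries0 (f : nat -> R) : limn (pseries f 0) = f 0%N.
Proof.
apply/cvg_lim => //; apply: cvg_near_cst.
exists 1%N => // -[//|N] _ /=; rewrite /pseries /series /= big_nat_recl // expr0 mulr1.
by rewrite big1 ?addr0 // => k _; rewrite expr0n mulr0.
Qed.

Lemma expm0 X : expm (RtoC 0 *: X) = 1%:M.
Proof.
apply/matrixP => i j; rewrite expm_entry /exp_entry !pseries0 expr0 fact0 invr1 !mul1r.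
by case: ((1 : 'M[C]_n) i j).
Qed.

End ExponentialSeries.

(* Locked: unification would otherwise unfold the limit defining [expm]. *)
HB.lock Definition evolution (R : realType) (n : nat) (H : 'M[complex R]_n) (s : R) :
  'M[complex R]_n := expm ((- iC * RtoC s) *: H).

(** * Mean value inequalities, unitary flows and conjugation by them *)

Section MeanValue.
Variables (R : realType) (n : nat).
Local Notation C := (complex R).
Implicit Types (F dF : R -> 'M[C]_n) (X H : 'M[C]_n).

(** [X] maps the basis vectors to its columns, which must therefore vanish. *)
Lemma opnorm_le0 X : opnorm X <= 0 -> X = 0.
Proof.
move=> X0; have {X0} X0 : opnorm X = 0 by apply/eqP; rewrite eq_le X0 opnorm_ge0.
apply/matrixP => i j; rewrite [RHS]mxE.
have : vnorm (X *m delta_mx j (0 : 'I_1)) <= 0.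
  by rewrite (le_trans (vnorm_mulmx _ _)) // X0 mul0r.
rewrite -colE => le0; have [] := coord_le_vnorm (col j X) i.
rewrite !mxE => h1 h2; apply: complex_ext; apply/eqP; rewrite -normr_le0;
exact: le_trans le0.
Qed.

(** The scalar function [rdot w (F t *m v)] has derivative at most [dG t * (vnorm w * vnorm v)], and
    derivatives of real functions can be compared. *)
Lemma opnorm_mean_value F dF (G dG : R -> R) (h : R) : 0 <= h ->
  (forall t, 0 < t < h -> mx_has_deriv F (dF t) t) ->
  (forall t, 0 < t < h -> is_derive t 1 G (dG t)) ->
  mx_continuous_on `[0, h] F -> {within `[0, h], continuous G} ->
  (forall t, 0 < t < h -> opnorm (dF t) <= dG t) ->
  opnorm (F h - F 0) <= G h - G 0.
Proof.
move=> h0 hF hG cF cG le.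
apply: opnorm_le_rdot => [|w v].
  (* The bound is nonnegative: [G] is nondecreasing, as its derivative dominates a norm. *)
  rewrite -[leLHS](subrr (0 : R)).
  apply: (@derive_le_le R (fun=> 0) G (fun=> 0) dG) => //.
  - exact: within_const.
  - by move=> t tin; rewrite (le_trans (opnorm_ge0 _) (le t tin)).
set k := vnorm w * vnorm v.
have k0 : 0 <= k by rewrite mulr_ge0 ?vnorm_ge0.
rewrite mulmxBl rdotDr rdotNr mulrBl.
apply: (@derive_le_le R (fun t => rdot w (F t *m v)) (fun t => G t * k)
  (fun t => rdot w (dF t *m v)) (fun t => dG t * k)) => //.
- by move=> t tin; apply: is_derive_rdot; exact: hF.
- move=> t tin; have := hG t tin => ?.
  by apply: is_derive_congr; rewrite /GRing.scale /=; ring.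
- exact: within_rdot.
- by apply: within_mul => //; exact: within_const.
- move=> t tin; rewrite (le_trans (ler_norm _)) // (le_trans (rdot_opnorm _ _ _)) //.
  by rewrite ler_wpM2r // le.
Qed.

Lemma mx_derive_continuous A F dF : (forall t, mx_has_deriv F (dF t) t) ->
  mx_continuous_on A F.
Proof.
move=> hF; apply: (mx_continuous_on_comp hF (f := id)).
by apply: continuous_subspaceT => x; exact: cvg_id.
Qed.

Lemma opnorm_mean_value_pow F dF (k : R) m (h : R) : 0 <= h ->
  (forall t, 0 < t < h -> mx_has_deriv F (dF t) t) ->
  mx_continuous_on `[0, h] F ->
  (forall t, 0 < t < h -> opnorm (dF t) <= k * t ^+ m) ->
  opnorm (F h - F 0) <= k / m.+1%:R * h ^+ m.+1.
Proof.
move=> h0 hF cF le.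
have hG (t : R) : is_derive t 1 (fun t => k / m.+1%:R * t ^+ m.+1) (k * t ^+ m).
  have := is_derive_mul (is_derive_const t (k / m.+1%:R)) (is_derive_pow t m).
  by congr (is_derive _ _ _ _); rewrite mul0r add0r mulrA divfK // pnatr_eq0.
have := @opnorm_mean_value F dF _ _ h h0 hF (fun t _ => hG t) cF
  (is_derive_within hG) le.
by rewrite expr0n mulr0 subr0.
Qed.

(** Negative [s] is reached by reflecting [t] to [- t]. Both signs occur, since the integrated
    coefficients [a] and [b] have no fixed sign. *)
Lemma opnorm_mean_value_line F dF (k : R) m (s : R) :
  (forall t, mx_has_deriv F (dF t) t) ->
  (forall t, opnorm (dF t) <= k * `|t| ^+ m) ->
  opnorm (F s - F 0) <= k / m.+1%:R * `|s| ^+ m.+1.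
Proof.
move=> hF le; have [s0|s0] := leP 0 s.
  rewrite (ger0_norm s0).
  apply: (@opnorm_mean_value_pow F dF) => //; first exact: mx_derive_continuous hF.
  by move=> t /andP[t0 _]; rewrite -[X in X ^+ _](gtr0_norm t0).
have hG t : mx_has_deriv (fun t => F (- t)) (RtoC (-1) *: dF (- t)) t.
  by apply: mx_has_deriv_comp; exact: hF.
rewrite (ltr0_norm s0) -[F s](congr1 F (opprK s)) -[F 0](congr1 F (oppr0 R)).
apply: (@opnorm_mean_value_pow (fun t => F (- t)) (fun t => RtoC (-1) *: dF (- t))).
- by rewrite oppr_ge0 ltW.
- by move=> t _.
- exact: mx_derive_continuous hG.
- move=> t /andP[t0 _]; rewrite (le_trans (opnormZ _ _)) // normrN1 mul1r.
  by have := le (- t); rewrite normrN gtr0_norm.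
Qed.

Lemma evolutionE H s : evolution H s = expm (RtoC s *: (- iC *: H)).
Proof. by rewrite evolution.unlock scalerA [RtoC s * _]mulrC. Qed.

Lemma mx_has_deriv_evolution H t :
  mx_has_deriv (evolution H) (- iC *: (H *m evolution H t)) t.
Proof. by rewrite (funext (evolutionE H)) scalemxAl; exact: mx_has_deriv_expm. Qed.

Lemma evolution0 H : evolution H 0 = 1%:M.
Proof. by rewrite evolutionE expm0. Qed.

Lemma adj_flow H X : is_hermitian H ->
  adjmx (- iC *: (H *m X)) = iC *: (adjmx X *m H).
Proof.
move=> hH; rewrite adjmxZ adjmxM (hermitian_adjmx hH); congr (_ *: _).
by apply: complex_ext; rewrite /= ?opprK ?oppr0.
Qed.

Lemma mx_has_deriv_gram H F t : is_hermitian H ->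
  mx_has_deriv F (- iC *: (H *m F t)) t ->
  mx_has_deriv (fun s => adjmx (F s) *m F s) 0 t.
Proof.
move=> hH hF; have := mx_has_derivM (mx_has_deriv_adj hF) hF.
by rewrite (adj_flow _ hH) -scalemxAl -scalemxAr mulmxA scaleNr subrr.
Qed.

Lemma mx_has_deriv_conj H F X t : is_hermitian H ->
  mx_has_deriv F (- iC *: (H *m F t)) t ->
  mx_has_deriv (fun s => adjmx (F s) *m X *m F s)
    (iC *: (adjmx (F t) *m mcomm H X *m F t)) t.
Proof.
move=> hH hF.
have := mx_has_derivM (mx_has_derivM (mx_has_deriv_adj hF) (mx_has_deriv_cst X t)) hF.
rewrite mulmx0 addr0 (adj_flow _ hH) -!scalemxAl -scalemxAr scaleNr /mcomm.
by rewrite mulmxBr mulmxBl scalerBr !mulmxA.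
Qed.

(** The Gram matrix [adjmx F *m F] has zero derivative and keeps its initial value. The generator
    may depend on time, as it does for the exact evolution. *)
Lemma flow_unitary (K : R -> 'M[C]_n) F (h : R) : 0 <= h ->
  (forall t, 0 < t < h -> is_hermitian (K t)) ->
  (forall t, 0 < t < h -> mx_has_deriv F (- iC *: (K t *m F t)) t) ->
  mx_continuous_on `[0, h] F -> F 0 = 1%:M -> unitary (F h).
Proof.
move=> h0 hK hF cF F0.
have : opnorm (adjmx (F h) *m F h - adjmx (F 0) *m F 0) <= 0.
  have := @opnorm_mean_value_pow (fun t => adjmx (F t) *m F t) (fun=> 0) 0 0 h h0.
  move=> mv; rewrite (le_trans (mv _ _ _)) //.
  - by move=> t tin; exact: mx_has_deriv_gram (hK t tin) (hF t tin).
  - by apply: mx_continuous_onM => //; exact: mx_continuous_on_adj.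
  - move=> t _; rewrite mul0r; apply: opnorm_le => // v.
    by rewrite mul0mx vnorm0 mul0r.
  - by rewrite !mul0r.
by move/opnorm_le0/eqP; rewrite subr_eq0 F0 adjmx1 mulmx1 => /eqP.
Qed.

Lemma mx_const F s : (forall t, mx_has_deriv F 0 t) -> F s = F 0.
Proof.
move=> hF; apply/eqP; rewrite -subr_eq0; apply/eqP/opnorm_le0.
rewrite (le_trans (@opnorm_mean_value_line F (fun=> 0) 0 0 s hF _)) ?mul0r //.
by move=> t; rewrite mul0r; apply: opnorm_le => // v; rewrite mul0mx vnorm0 mul0r.
Qed.

Lemma evolution_unitary H s : is_hermitian H -> unitary (evolution H s).
Proof.
move=> hH; have e t := mx_has_deriv_evolution H t.
have := @mx_const (fun s => adjmx (evolution H s) *m evolution H s) s.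
rewrite evolution0 adjmx1 mulmx1; apply => t.
exact: mx_has_deriv_gram hH (e t).
Qed.

(** The Heisenberg picture: for Hermitian [H] this is [exp (i s H) X exp (- i s H)]. *)
Definition heis H s X := adjmx (evolution H s) *m X *m evolution H s.

Lemma mx_has_deriv_heis H X t : is_hermitian H ->
  mx_has_deriv (fun s => heis H s X) (iC *: heis H t (mcomm H X)) t.
Proof. by move=> hH; exact: mx_has_deriv_conj hH (mx_has_deriv_evolution H t). Qed.

Lemma heis0 H X : heis H 0 X = X.
Proof. by rewrite /heis evolution0 adjmx1 mulmx1 mul1mx. Qed.

Lemma opnorm_conjV (Q X : 'M[C]_n) : unitary Q -> opnorm (adjmx Q *m X *m Q) <= opnorm X.
Proof. by move=> /unitary_adj/(@opnorm_conj _ _ _ X); rewrite adjmxK. Qed.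

Lemma opnorm_heis H s X : is_hermitian H -> opnorm (heis H s X) <= opnorm X.
Proof. by move=> hH; apply: opnorm_conjV; exact: evolution_unitary. Qed.

(** The derivative is [i] times the conjugate of [[H, X]], and unitary conjugation does not increase
    the norm. *)
Lemma heis_first_order H s X : is_hermitian H ->
  opnorm (heis H s X - X) <= opnorm (mcomm H X) * `|s|.
Proof.
move=> hH; have := @opnorm_mean_value_line (fun s => heis H s X)
  (fun s => iC *: heis H s (mcomm H X)) (opnorm (mcomm H X)) 0 s.
rewrite heis0 divr1 expr1; apply => t; first exact: mx_has_deriv_heis.
by rewrite expr0 mulr1; exact: (le_trans (opnormZi _) (opnorm_heis _ _ hH)).
Qed.

(** Without its linear term the function has derivative [i (heis H s [H, X] - [H, X])], which the
    first-order bound for [[H, X]] controls; integration gives the factor 1/2. *)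
Lemma heis_second_order H s X : is_hermitian H ->
  opnorm (heis H s X - X - RtoC s *: (iC *: mcomm H X)) <=
  opnorm (mcomm H (mcomm H X)) / 2 * s ^+ 2.
Proof.
move=> hH; rewrite -[s ^+ 2](real_normK (num_real s)).
have := @opnorm_mean_value_line
  (fun s => heis H s X + RtoC s *: - (iC *: mcomm H X))
  (fun s => iC *: heis H s (mcomm H X) + RtoC 1 *: - (iC *: mcomm H X))
  (opnorm (mcomm H (mcomm H X))) 1 s.
have -> : heis H s X + RtoC s *: - (iC *: mcomm H X) -
    (heis H 0 X + RtoC 0 *: - (iC *: mcomm H X)) =
    heis H s X - X - RtoC s *: (iC *: mcomm H X).
  rewrite heis0 (_ : RtoC 0 = 0 :> C); last exact: complex_ext.
  by move: (heis H s X) (iC *: _) => A B; rewrite scale0r addr0 scalerN addrAC.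
apply => t.
  apply: mx_has_derivD; first exact: mx_has_deriv_heis.
  by apply: mx_has_derivZ; exact: is_derive_id.
rewrite expr1 (_ : RtoC 1 = 1 :> C); last exact: complex_ext.
rewrite scale1r -scalerBr.
exact: (le_trans (opnormZi _) (heis_first_order _ _ hH)).
Qed.

(** The first-order bound with [X := H] is zero because [[H, H] = 0], so conjugation fixes [H]. *)
Lemma evolution_comm H s : is_hermitian H ->
  evolution H s *m H = H *m evolution H s.
Proof.
move=> hH; have : opnorm (heis H s H - H) <= 0.
  apply: (le_trans (heis_first_order _ _ hH)); rewrite /mcomm subrr.
  have -> : opnorm (0 : 'M[C]_n) = 0; last by rewrite mul0r.
  apply/eqP; rewrite eq_le opnorm_ge0 andbT; apply: opnorm_le => // v.
  by rewrite mul0mx vnorm0 mul0r.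
move=> /opnorm_le0/eqP; rewrite subr_eq0 => /eqP e.
have := congr1 (mulmx (evolution H s)) e.
by rewrite /heis !mulmxA (unitaryV (evolution_unitary s hH)) mul1mx => <-.
Qed.

(** The product of [evolution H (- s)] and [evolution H s] has zero derivative, so the two are
    inverse, and the inverse of a unitary matrix is its adjoint. *)
Lemma adj_evolution H s : is_hermitian H ->
  adjmx (evolution H s) = evolution H (- s).
Proof.
move=> hH; have e : evolution H (- s) *m evolution H s = 1%:M.
  have := @mx_const (fun s => evolution H (- s) *m evolution H s) s.
  rewrite oppr0 evolution0 mulmx1; apply => t.
  have dN := mx_has_deriv_comp (mx_has_deriv_evolution H (- t))
    (is_derive_opp (is_derive_id t 1)).
  have := mx_has_derivM dN (mx_has_deriv_evolution H t).
  have alg (N E : 'M[C]_n) : N *m H = H *m N ->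
      RtoC (-1) *: (- iC *: (H *m N)) *m E + N *m (- iC *: (H *m E)) = 0.
    move=> cNH; rewrite (_ : RtoC (-1) = -1 :> C); last first.
      by apply: complex_ext; rewrite /= ?oppr0.
    by rewrite scaleN1r scaleNr opprK -scalemxAl -scalemxAr mulmxA cNH scaleNr subrr.
  by rewrite (alg _ _ (evolution_comm (- t) hH)).
rewrite -[LHS]mul1mx -e -mulmxA (unitaryV (evolution_unitary s hH)).
by rewrite mulmx1.
Qed.

End MeanValue.

(** Grouping by order of smallness. Here [c] stands for [i [H1, H2]], [A] and [B] for the conjugates
    of [H1] and [H2], and the last two terms are second-order remainders. The signs in
    [(- b) *: - c] come from the time [- b] and from [[H2, H1] = - [H1, H2]]. *)
Lemma generator_split (K : comNzRingType) m n (H1 H2 A B c : 'M[K]_(m, n))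
  (f1 f2 da db a b p q r : K) :
  da *: H1 + db *: H2 + (p + q + r) *: A - f1 *: H1 - f2 *: B =
  (da + p + q - f1) *: H1 + r *: A + (db - f2) *: H2
  + q *: (A - H1) + (p * b - f2 * a) *: c
  + p *: (A - H1 - (- b) *: - c) + (- f2) *: (B - H2 - a *: c).
Proof. by apply/matrixP => i j; rewrite !mxE; ring. Qed.

(** * Algebra of the interaction generator, over any commutative ring *)

Section Generator.
Variables (K : comNzRingType) (n : nat) (H1 H2 U P P' Q Q' S : 'M[K]_n).
Variables (z f1 f2 da db dc : K).
Hypotheses (PV : P' *m P = 1%:M) (VP : P *m P' = 1%:M) (QV : Q' *m Q = 1%:M).
Hypothesis cP : P *m H1 = H1 *m P.

(** The common generator is placed between [P] and [Q]: the [H1] coming from [P] commutes with [P]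
    and arrives unchanged, the one coming from [S] arrives conjugated by [Q]. *)
Lemma product_generator :
  (da *: (- z *: (H1 *m P)) *m Q + P *m (db *: (- z *: (H2 *m Q)))) *m S
    + P *m Q *m (dc *: (- z *: (H1 *m S))) =
  - z *: (P *m (da *: H1 + db *: H2 + dc *: (Q *m H1 *m Q')) *m (Q *m S)).
Proof.
rewrite !scalerA ![_ * - z]mulrC -!scalerA.
rewrite 2!mulmxDr !mulmxDl !scalerDr -!(scalemxAr, scalemxAl).
congr (- z *: (_ *: _) + - z *: (_ *: _) + - z *: (_ *: _)).
- by rewrite cP !mulmxA.
- by rewrite !mulmxA.
- by rewrite -!mulmxA [Q' *m _]mulmxA QV mul1mx.
Qed.

(** To be read with the adjoint of the exact evolution as [U], and [z = i]. Moving the exact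
    generator through [P] conjugates only [H2], since [H1] commutes with [P]. *)
Lemma interaction_derivative :
  z *: (U *m (f1 *: H1 + f2 *: H2)) *m (P *m Q *m S) + U *m
  ((da *: (- z *: (H1 *m P)) *m Q + P *m (db *: (- z *: (H2 *m Q)))) *m S
    + P *m Q *m (dc *: (- z *: (H1 *m S)))) =
  - z *: (U *m
    (P *m (da *: H1 + db *: H2 + dc *: (Q *m H1 *m Q')
       - f1 *: H1 - f2 *: (P' *m H2 *m P)) *m P') *m (P *m Q *m S)).
Proof.
rewrite product_generator.
set Z := (X in P *m X *m (Q *m S)); set Y := f1 *: H1 + f2 *: (P' *m H2 *m P).
have KE : (f1 *: H1 + f2 *: H2) *m P = P *m Y.
  by rewrite mulmxDl mulmxDr -!scalemxAl -!scalemxAr cP !mulmxA VP mul1mx.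
have -> : Z - f1 *: H1 - f2 *: (P' *m H2 *m P) = Z - Y by rewrite opprD addrA.
rewrite -!mulmxA (mulmxA P' P) PV mul1mx -[z *: _ *m _]scalemxAl -mulmxA.
rewrite (mulmxA _ P) KE !scaleNr.
by rewrite mulmxBl !mulmxBr mulmxN -scalemxAr -!mulmxA scalerBr opprB addrC.
Qed.

End Generator.

(** * The error bound for a general step *)

Section TrotterError.
Variables (R : realType) (n : nat) (H1 H2 : 'M[complex R]_n).
Hypotheses (hH1 : is_hermitian H1) (hH2 : is_hermitian H2).
Local Notation C := (complex R).

Lemma is_hermitian_comb (x y : R) : is_hermitian (RtoC x *: H1 + RtoC y *: H2).
Proof.
move=> i j; rewrite !mxE hH1 hH2 cconjD !cconjM.
by congr (_ * _ + _ * _); apply: complex_ext; rewrite /= ?oppr0.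
Qed.

Lemma mcommNr (X Y : 'M[C]_n) : mcomm X (- Y) = - mcomm X Y.
Proof. by rewrite /mcomm mulmxN mulNmx opprB opprK addrC. Qed.

Lemma mcommC (X Y : 'M[C]_n) : mcomm X Y = - mcomm Y X.
Proof. by rewrite /mcomm opprB. Qed.

Lemma opnorm_mcommC (X Y : 'M[C]_n) : opnorm (mcomm X Y) = opnorm (mcomm Y X).
Proof. by rewrite mcommC opnormN. Qed.

Lemma opnormD_le (A B : 'M[C]_n) (x y : R) :
  opnorm A <= x -> opnorm B <= y -> opnorm (A + B) <= x + y.
Proof. by move=> hA hB; apply: le_trans (opnormD A B) (lerD hA hB). Qed.

Lemma opnormZ_le (A : 'M[C]_n) (x y : R) :
  opnorm A <= y -> opnorm (RtoC x *: A) <= `|x| * y.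
Proof. by move=> hA; apply: le_trans (opnormZ A x) _; rewrite ler_wpM2l. Qed.

(* The splitting [p + q + r] of the derivative of the last exponent selects how far
   each part of [heis H2 (- b) H1] is expanded: to second order, to first order, not at all. *)
Lemma generator_error (f1 f2 da db a b p q r : R) :
  opnorm (RtoC da *: H1 + RtoC db *: H2 + RtoC (p + q + r) *: heis H2 (- b) H1
          - RtoC f1 *: H1 - RtoC f2 *: heis H1 a H2) <=
  `|da + p + q - f1| * opnorm H1 + `|r| * opnorm H1 + `|db - f2| * opnorm H2
  + `|q| * (opnorm (mcomm H1 H2) * `|b|)
  + `|p * b - f2 * a| * opnorm (mcomm H1 H2)
  + `|p| * (opnorm (mcomm H2 (mcomm H2 H1)) / 2 * b ^+ 2)
  + `|f2| * (opnorm (mcomm H1 (mcomm H1 H2)) / 2 * a ^+ 2).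
Proof.
have K1 := heis_first_order (- b) H1 hH2.
have K2 := heis_second_order (- b) H1 hH2.
have K3 := heis_second_order a H2 hH1.
have K4 := opnorm_heis (- b) H1 hH2.
rewrite normrN (opnorm_mcommC H2 H1) in K1; rewrite sqrrN in K2.
move: (mcommC H2 H1) K1 K2 K3 K4; move: (mcomm H2 (mcomm H2 H1)) (mcomm H1 (mcomm H1 H2)).
move: (mcomm H1 H2) (mcomm H2 H1) (heis H2 (- b) H1) (heis H1 a H2).
move=> c d A B c221 c112 -> K1 K2 K3 K4.
have -> : RtoC da *: H1 + RtoC db *: H2 + RtoC (p + q + r) *: A
          - RtoC f1 *: H1 - RtoC f2 *: B =
  RtoC (da + p + q - f1) *: H1 + RtoC r *: A + RtoC (db - f2) *: H2
  + RtoC q *: (A - H1) + RtoC (p * b - f2 * a) *: (iC *: c)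
  + RtoC p *: (A - H1 - RtoC (- b) *: (iC *: - c))
  + RtoC (- f2) *: (B - H2 - RtoC a *: (iC *: c)).
  rewrite [RtoC (p + q + r)]RtoCD [RtoC (p + q)]RtoCD.
  rewrite [RtoC (da + p + q - f1)]RtoCD [RtoC (da + p + q)]RtoCD [RtoC (da + p)]RtoCD.
  rewrite [RtoC (db - f2)]RtoCD [RtoC (p * b - f2 * a)]RtoCD !RtoCN !RtoCM.
  by rewrite [iC *: - c]scalerN; exact: generator_split.
rewrite -[`|f2|]normrN.
apply: opnormD_le; last exact: opnormZ_le K3.
apply: opnormD_le; last exact: opnormZ_le K2.
apply: opnormD_le; last exact: opnormZ_le (opnormZi c).
apply: opnormD_le; last exact: opnormZ_le K1.
apply: opnormD_le; last exact: opnormZ.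
by apply: opnormD_le; [exact: opnormZ|exact: opnormZ_le K4].
Qed.
Lemma opnorm_unitary2 (P A Q : 'M[C]_n) : unitary P -> unitary Q ->
  opnorm (P *m A *m Q) <= opnorm A.
Proof.
move=> uP uQ; apply: opnorm_le => [|v]; first exact: opnorm_ge0.
rewrite -!mulmxA (vnorm_unitary _ uP); apply: (le_trans (vnorm_mulmx _ _)).
by rewrite vnorm_unitary.
Qed.

(** One statement serves all four steps: each is a choice of [a], [b], [c] and of a splitting of the
    derivative of [c]. The last hypothesis is about the right side of [generator_error]. *)
Lemma trotter_error (f1 f2 a da b db c p q r : R -> R) (U : R -> 'M[C]_n)
    (k h : R) (m : nat) : 0 <= h ->
  a 0 = 0 -> b 0 = 0 -> c 0 = 0 -> U 0 = 1%:M -> mx_continuous_on `[0, h] U ->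
  (forall t, 0 < t < h -> mx_has_deriv U
     (- iC *: ((RtoC (f1 t) *: H1 + RtoC (f2 t) *: H2) *m U t)) t) ->
  (forall t, 0 < t < h -> is_derive t 1 a (da t)) ->
  (forall t, 0 < t < h -> is_derive t 1 b (db t)) ->
  (forall t, 0 < t < h -> is_derive t 1 c (p t + q t + r t)) ->
  {within `[0, h], continuous a} -> {within `[0, h], continuous b} ->
  {within `[0, h], continuous c} ->
  (forall t, 0 < t < h ->
    `|da t + p t + q t - f1 t| * opnorm H1 + `|r t| * opnorm H1
    + `|db t - f2 t| * opnorm H2
    + `|q t| * (opnorm (mcomm H1 H2) * `|b t|)
    + `|p t * b t - f2 t * a t| * opnorm (mcomm H1 H2)
    + `|p t| * (opnorm (mcomm H2 (mcomm H2 H1)) / 2 * b t ^+ 2)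
    + `|f2 t| * (opnorm (mcomm H1 (mcomm H1 H2)) / 2 * a t ^+ 2) <= k * t ^+ m) ->
  opnorm (evolution H1 (a h) *m evolution H2 (b h) *m evolution H1 (c h) - U h)
  <= k / m.+1%:R * h ^+ m.+1.
Proof.
move=> h0 a0 b0 c0 U0 cU dU dA dB dC ca cb cc bound.
(* Unitarity is needed at interior times and at [h], so the flow is restricted to [[0, t]]. *)
have uU t : 0 <= t <= h -> unitary (U t).
  move=> /andP[t0 th].
  apply: (@flow_unitary _ _ (fun t => RtoC (f1 t) *: H1 + RtoC (f2 t) *: H2)) => //.
  - by move=> s _; exact: is_hermitian_comb.
  - by move=> s /andP[s0 st]; apply: dU; rewrite s0 (lt_le_trans st).
  - by apply: mx_continuous_onW cU; apply: subset_itvl; rewrite bnd_simp.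
set V := fun t => evolution H1 (a t) *m evolution H2 (b t) *m evolution H1 (c t).
have uV t : unitary (V t).
  by apply: unitaryM; [apply: unitaryM|]; exact: evolution_unitary.
pose X t := RtoC (da t) *: H1 + RtoC (db t) *: H2
  + RtoC (p t + q t + r t) *: heis H2 (- b t) H1
  - RtoC (f1 t) *: H1 - RtoC (f2 t) *: heis H1 (a t) H2.
have dW t : 0 < t < h -> mx_has_deriv (fun t => adjmx (U t) *m V t)
    (- iC *: (adjmx (U t) *m
       (evolution H1 (a t) *m X t *m adjmx (evolution H1 (a t))) *m V t)) t.
  move=> tin.
  have dE (H : 'M[C]_n) (g : R -> R) dg := @mx_has_deriv_comp _ _ (evolution H) _ g dg t
    (mx_has_deriv_evolution H (g t)).
  have dV := mx_has_derivM (mx_has_derivM (dE H1 _ _ (dA t tin)) (dE H2 _ _ (dB t tin)))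
    (dE H1 _ _ (dC t tin)).
  have := mx_has_derivM (mx_has_deriv_adj (dU t tin)) dV.
  rewrite (adj_flow _ (is_hermitian_comb _ _)).
  have uP := evolution_unitary (a t) hH1; have uQ := evolution_unitary (b t) hH2.
  rewrite (interaction_derivative _ _ _ _ _ _ _ _ _ uP (unitaryV uP) uQ
    (evolution_comm (a t) hH1)).
  (* [heis] has the adjoint on the left; conjugation the other way round is [heis] at the opposite
     time. *)
  have hE : heis H2 (- b t) H1 =
      evolution H2 (b t) *m H1 *m adjmx (evolution H2 (b t)).
    by rewrite /heis -(adj_evolution (b t) hH2) adjmxK.
  by rewrite /X hE /heis; apply.
have cV : mx_continuous_on `[0, h] V.
  apply: mx_continuous_onM; first apply: mx_continuous_onM;
  exact: (mx_continuous_on_comp (mx_has_deriv_evolution _)).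
have : opnorm (adjmx (U h) *m V h - adjmx (U 0) *m V 0) <= k / m.+1%:R * h ^+ m.+1.
  apply: (opnorm_mean_value_pow h0 dW).
    by apply: mx_continuous_onM cV; exact: mx_continuous_on_adj.
  move=> t tin; apply: le_trans (bound t tin).
  apply: le_trans (generator_error _ _ _ _ _ _ _ _ _).
  rewrite scaleNr opnormN; apply: (le_trans (opnormZi _)).
  have ut : unitary (adjmx (U t)).
    by apply: unitary_adj; apply: uU; case/andP: tin => t0 th; rewrite !ltW.
  apply: (le_trans (opnorm_unitary2 _ ut (uV t))).
  exact: (opnorm_conj _ (evolution_unitary _ hH1)).
rewrite /V a0 b0 c0 U0 !evolution0 !mulmx1 adjmx1 -/(V h) => le.
apply: le_trans le; have uh : unitary (U h) by apply: uU; rewrite h0 lexx.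
rewrite -[V h - U h]mulmx1.
have -> : V h - U h = U h *m (adjmx (U h) *m V h - 1%:M).
  by rewrite mulmxBr mulmxA (unitaryV uh) mul1mx mulmx1.
by apply: opnorm_unitary2; rewrite // /unitary adjmx1 mulmx1.
Qed.

End TrotterError.

(** * Suprema, Taylor estimates and integrals of real functions *)

Section RealEstimates.
Variable R : realType.
Implicit Types (f df ddf : R -> R) (T s t h : R).
Notation mu := (@lebesgue_measure R).

Lemma within_itvW f (a b c d : R) : a <= c -> d <= b ->
  {within `[a, b], continuous f} -> {within `[c, d], continuous f}.
Proof.
by move=> ac db; apply: continuous_subspaceW; apply: subset_itvScc.
Qed.

Lemma norm_le_supnorm T f t : {within `[0, T], continuous f} -> 0 <= t <= T ->
  `|f t| <= supnorm T f.
Proof.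
move=> cf tin; have T0 : 0 <= T by case/andP: tin; exact: le_trans.
apply: ub_le_sup; last by exists t => //=; rewrite in_itv.
have [|c cin hc] := @EVT_max R (fun t => `|f t|) 0 T T0.
  by apply: (@within_comp R _ f (fun x => `|x|)) => // x; exact: norm_continuous.
by exists (`|f c|) => _ [u uin <-]; apply: hc.
Qed.

Lemma supnorm_ge0 T f : 0 <= T -> {within `[0, T], continuous f} -> 0 <= supnorm T f.
Proof.
by move=> T0 cf; apply: le_trans (norm_le_supnorm cf (_ : 0 <= T <= T)); rewrite ?T0 /=.
Qed.

Lemma within_id A : {within A, continuous (id : R -> R)}.
Proof. by apply: continuous_subspaceT => x; exact: cvg_id. Qed.

Lemma norm_sub_le f df M s t : s <= t ->
  (forall u, s < u < t -> is_derive u 1 f (df u)) ->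
  {within `[s, t], continuous f} -> (forall u, s < u < t -> `|df u| <= M) ->
  `|f t - f s| <= M * (t - s).
Proof.
move=> st hf cf le; rewrite mulrBr.
apply: (@norm_derive_le R f (fun u => M * u) df (fun=> M)) => //.
  by move=> u _; apply: is_derive_congr; rewrite /GRing.scale /=; ring.
by apply: within_mul; [exact: within_const|exact: within_id].
Qed.

(** Stated with a Lipschitz bound for [df] at [s], so that it applies both to [f] and to the
    integral of [f]. The comparison function is [M / 2 * (u - s) ^+ 2] up to a constant. *)
Lemma taylor1_le f df M s t : s <= t ->
  (forall u, s < u < t -> is_derive u 1 f (df u)) ->
  {within `[s, t], continuous f} ->
  (forall u, s < u < t -> `|df u - df s| <= M * (u - s)) ->
  `|f t - f s - (t - s) * df s| <= M / 2 * (t - s) ^+ 2.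
Proof.
move=> st hf cf le.
have dG (u : R) : is_derive u 1 (fun u => M / 2 * (u * u) - (M * s) * u) (M * (u - s)).
  by apply: is_derive_congr; rewrite /GRing.scale /=; field.
have := @norm_derive_le R (fun u => f u - u * df s) _ (fun u => df u - df s) _ s t st _
  (fun u _ => dG u) _ (is_derive_within dG) le.
have -> : M / 2 * (t * t) - M * s * t - (M / 2 * (s * s) - M * s * s) =
  M / 2 * (t - s) ^+ 2 by field.
have -> : f t - t * df s - (f s - s * df s) = f t - f s - (t - s) * df s by ring.
apply.
  by move=> u uin; have := hf u uin => ?; apply: is_derive_congr; rewrite /GRing.scale /=; ring.
apply: within_add => //; apply: within_opp; apply: within_mul;
  [exact: within_id|exact: within_const].
Qed.

Lemma integ0 f : integ 0 0 f = 0.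
Proof. by rewrite /integ set_itv1 Rintegral_set1. Qed.

Lemma continuous_integrable f T : {within `[0, T], continuous f} ->
  mu.-integrable `[0, T] (EFin \o f).
Proof. by move=> cf; apply: continuous_compact_integrable => //; exact: segment_compact. Qed.

Lemma is_derive_integ f T t : {within `[0, T], continuous f} -> 0 < t < T ->
  is_derive t 1 (fun s => integ 0 s f) (f t).
Proof.
move=> cf tin; have /andP[t0 tT] := tin.
have [|d e] := @continuous_FTC1_closed R f 0 t T tT (continuous_integrable cf) t0.
  by apply: (within_continuous_continuous _ cf); rewrite ?(lt_trans t0) // in_itv.
by have := derivableP d; rewrite -derive1E e.
Qed.

Lemma within_integ f T : 0 <= T -> {within `[0, T], continuous f} ->
  {within `[0, T], continuous (fun s => integ 0 s f)}.
Proof.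
by move=> T0 cf; exact: (parameterized_integral_continuous T0 (continuous_integrable cf)).
Qed.

Lemma integ_sub f T s t : {within `[0, T], continuous f} -> 0 <= s -> s <= t -> t <= T ->
  integ s t f = integ 0 t f - integ 0 s f.
Proof.
move=> cf s0 st tT.
have ci : mu.-integrable `[0, t] (EFin \o f).
  by apply: continuous_integrable; apply: within_itvW cf.
(* Removing [[0, s]] from [[0, t]] leaves an interval open at [s]; the missing point has measure
   zero. *)
rewrite /integ Rintegral_itvB ?bnd_simp // Rintegral_itv_obnd_cbnd //.
by apply: (integrableS _ _ _ ci) => //; apply: subset_itvr; rewrite bnd_simp.
Qed.

Lemma C2_lipschitz T f df ddf s t : C2_on T f df ddf -> 0 <= s -> s <= t -> t <= T ->
  `|f t - f s| <= supnorm T df * (t - s).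
Proof.
move=> [d [cf [cdf _]]] s0 st tT; apply: (@norm_sub_le f df) => //.
- by move=> u /andP[su ut]; apply: (d u _).1; rewrite (le_lt_trans s0) //= (lt_le_trans ut).
- exact: within_itvW cf.
- move=> u /andP[su ut]; apply: norm_le_supnorm => //.
  by rewrite (le_trans s0) ?ltW // (lt_le_trans ut).
Qed.

Lemma C2_taylor T f df ddf s t : C2_on T f df ddf -> 0 <= s -> s <= t -> t <= T ->
  `|f t - f s - (t - s) * df s| <= supnorm T ddf / 2 * (t - s) ^+ 2.
Proof.
move=> [d [cf [cdf cddf]]] s0 st tT; apply: taylor1_le => //.
- by move=> u /andP[su ut]; apply: (d u _).1; rewrite (le_lt_trans s0) //= (lt_le_trans ut).
- exact: within_itvW cf.
move=> u /andP[su ut]; apply: (@norm_sub_le df ddf); first exact: ltW.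
- move=> v /andP[sv vu]; apply: (d v _).2.
  by rewrite (le_lt_trans s0) //= (lt_trans vu) ?(lt_le_trans ut).
- by apply: within_itvW cdf; rewrite // (le_trans (ltW ut)).
- move=> v /andP[sv vu]; apply: norm_le_supnorm => //.
  by rewrite (le_trans s0) ?ltW // (lt_trans vu) ?(lt_le_trans ut).
Qed.

Lemma integ_le T f t : {within `[0, T], continuous f} -> 0 <= t <= T ->
  `|integ 0 t f| <= supnorm T f * t.
Proof.
move=> cf /andP[t0 tT]; have T0 := le_trans t0 tT.
have := @norm_sub_le (fun s => integ 0 s f) f (supnorm T f) 0 t t0.
rewrite integ0 !subr0; apply.
- by move=> u /andP[u0 ut]; apply: is_derive_integ cf _; rewrite u0 (lt_le_trans ut).
- by apply: within_itvW (within_integ T0 cf).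
- by move=> u /andP[u0 ut]; apply: norm_le_supnorm => //; rewrite ltW ?(ltW (lt_le_trans ut tT)).
Qed.

Lemma integ_taylor T f df ddf s t : C2_on T f df ddf -> 0 <= s -> s <= t -> t <= T ->
  `|integ 0 t f - integ 0 s f - (t - s) * f s| <= supnorm T df / 2 * (t - s) ^+ 2.
Proof.
move=> c2 s0 st tT; have [_ [cf _]] := c2.
have T0 : 0 <= T by rewrite (le_trans s0) ?(le_trans st).
apply: (@taylor1_le (fun s => integ 0 s f)) => //.
- move=> u /andP[su ut]; apply: is_derive_integ cf _.
  by rewrite (le_lt_trans s0) ?(lt_le_trans ut).
- exact: within_itvW (within_integ T0 cf).
- move=> u /andP[su ut]; apply: (C2_lipschitz c2) => //; first exact: ltW.
  exact: le_trans (ltW ut) tT.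
Qed.

End RealEstimates.

(** The right side of [generator_error] is monotone in the absolute values of its scalars, so each
    may be replaced by an upper bound. *)
Lemma error_terms_le (R : realType) (n1 n2 c12 c221 c112 : R)
    (e1 r e2 q b e3 p f a : R) (x1 xr x2 xq xb x3 xp xf xa : R) :
  0 <= n1 -> 0 <= n2 -> 0 <= c12 -> 0 <= c221 -> 0 <= c112 ->
  `|e1| <= x1 -> `|r| <= xr -> `|e2| <= x2 -> `|q| <= xq -> `|b| <= xb ->
  `|e3| <= x3 -> `|p| <= xp -> `|f| <= xf -> `|a| <= xa ->
  `|e1| * n1 + `|r| * n1 + `|e2| * n2 + `|q| * (c12 * `|b|) + `|e3| * c12
   + `|p| * (c221 / 2 * b ^+ 2) + `|f| * (c112 / 2 * a ^+ 2) <=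
  x1 * n1 + xr * n1 + x2 * n2 + xq * (c12 * xb) + x3 * c12
   + xp * (c221 / 2 * xb ^+ 2) + xf * (c112 / 2 * xa ^+ 2).
Proof.
move=> n10 n20 c0 c1 c2 h1 hr h2 hq hb h3 hp hf ha.
have sq (y xy : R) : `|y| <= xy -> y ^+ 2 <= xy ^+ 2.
  by move=> hy; rewrite -(real_normK (num_real y)) lerXn2r // nnegrE // (le_trans _ hy).
repeat apply: lerD; try (by apply: ler_wpM2r); apply: ler_pM => //.
- by rewrite mulr_ge0.
- by rewrite ler_wpM2l.
- by rewrite mulr_ge0 ?sqr_ge0 ?divr_ge0.
- by rewrite ler_wpM2l ?divr_ge0 // sq.
- by rewrite mulr_ge0 ?sqr_ge0 ?divr_ge0.
- by rewrite ler_wpM2l ?divr_ge0 // sq.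
Qed.

(** * The four Trotter steps *)

Section OneStep.
Variables (R : realType) (n : nat) (H1 H2 : 'M[complex R]_n).
Variables (T h : R) (f1 df1 ddf1 f2 df2 ddf2 : R -> R) (U : R -> 'M[complex R]_n).
Hypotheses (hH1 : is_hermitian H1) (hH2 : is_hermitian H2).
Hypotheses (c2f1 : C2_on T f1 df1 ddf1) (c2f2 : C2_on T f2 df2 ddf2).
Hypotheses (h0 : 0 < h) (hT : h <= T) (U0 : U 0 = 1%:M).
Hypothesis cU : mx_continuous_on `[0, T] U.
Hypothesis dU : forall t, 0 < t < T -> mx_has_deriv U
  (- iC *: ((RtoC (f1 t) *: H1 + RtoC (f2 t) *: H2) *m U t)) t.

Local Notation nf1 := (supnorm T f1).
Local Notation nf2 := (supnorm T f2).
Local Notation nd1 := (supnorm T df1).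
Local Notation nd2 := (supnorm T df2).
Local Notation ndd1 := (supnorm T ddf1).
Local Notation ndd2 := (supnorm T ddf2).
Local Notation nH1 := (opnorm H1).
Local Notation nH2 := (opnorm H2).
Local Notation c12 := (opnorm (mcomm H1 H2)).
Local Notation c112 := (opnorm (mcomm H1 (mcomm H1 H2))).
Local Notation c221 := (opnorm (mcomm H2 (mcomm H2 H1))).

(* [ring] and [lra] compare the norms by conversion unless these are variables. *)
Ltac abstract_norms :=
  move: (supnorm T f1) (supnorm T f2) (supnorm T df1) (supnorm T df2)
    (supnorm T ddf1) (supnorm T ddf2) (opnorm H1) (opnorm H2) (opnorm (mcomm H1 H2))
    (opnorm (mcomm H1 (mcomm H1 H2))) (opnorm (mcomm H2 (mcomm H2 H1))).

Let cU_h : mx_continuous_on `[0, h] U.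
Proof. by apply: mx_continuous_onW cU; apply: subset_itvl; rewrite bnd_simp. Qed.

Let dU_h (t : R) : 0 < t < h -> mx_has_deriv U
  (- iC *: ((RtoC (f1 t) *: H1 + RtoC (f2 t) *: H2) *m U t)) t.
Proof. by move=> /andP[t0 th]; apply: dU; rewrite t0 (lt_le_trans th). Qed.

Let in_T (t : R) : 0 < t < h -> 0 < t < T.
Proof. by move=> /andP[-> th]; rewrite (lt_le_trans th). Qed.

Let half_in_T (t : R) : 0 < t < h -> 0 < t / 2 < T.
Proof. by move=> /andP[t0 th]; rewrite divr_gt0 //=; move: hT th t0 => *; lra. Qed.

Let ltW2 (x a b : R) : a < x < b -> a <= x <= b.
Proof. by move=> /andP[ax xb]; rewrite !ltW. Qed.

Let f1_cont : {within `[0, T], continuous f1}. Proof. by case: c2f1 => _ []. Qed.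
Let f2_cont : {within `[0, T], continuous f2}. Proof. by case: c2f2 => _ []. Qed.
Let df1_cont : {within `[0, T], continuous df1}. Proof. by case: c2f1 => _ [_ []]. Qed.
Let df2_cont : {within `[0, T], continuous df2}. Proof. by case: c2f2 => _ [_ []]. Qed.
Let to_h (f : R -> R) : {within `[0, T], continuous f} -> {within `[0, h], continuous f}.
Proof. by apply: within_itvW. Qed.

(** The derivative of [t * f1 t] is split into [q = f1], which cancels the exact coefficient, and
    [r = t * df1 t], already of first order and so bounded without a commutator. *)
Lemma standard_order1 :
  opnorm (evolution H2 (f2 h * h) *m evolution H1 (f1 h * h) - U h) <=
  (nd1 * nH1 + nd2 * nH2 + nf1 * nf2 * c12) / 2 * h ^+ 2.
Proof.
have d1 t tin := (c2f1.1 t (in_T tin)).1; have d2 t tin := (c2f2.1 t (in_T tin)).1.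
have := @trotter_error _ _ _ _ hH1 hH2 f1 f2 (fun=> 0) (fun=> 0) (fun t => f2 t * t)
  (fun t => df2 t * t + f2 t * 1) (fun t => f1 t * t) (fun=> 0) f1 (fun t => df1 t * t) U
  (nd1 * nH1 + nd2 * nH2 + nf1 * nf2 * c12) h 1 (ltW h0) erefl.
rewrite !mulr0 evolution0 mul1mx; apply => //.
- by move=> t tin; apply: is_derive_mul => //; exact: d2.
- move=> t tin; have := is_derive_mul (d1 t tin) (is_derive_id t 1).
  by congr (is_derive _ _ _ _); ring.
- exact: within_const.
- by apply: within_mul; [exact: to_h|exact: within_id].
- by apply: within_mul; [exact: to_h|exact: within_id].
- move=> t tin; have tT := ltW2 (in_T tin); have /andP[t0 _] := tin.
  apply: (le_trans (error_terms_le (x1 := 0) (xr := nd1 * t) (x2 := nd2 * t) (xq := nf1)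
    (xb := nf2 * t) (x3 := 0) (xp := 0) (xf := nf2) (xa := 0) _ _ _ _ _ _ _ _ _ _ _ _ _ _));
    rewrite ?opnorm_ge0 ?norm_le_supnorm ?normr0 //.
  + by rewrite !add0r subrr normr0.
  + by rewrite normrM [`|t|]gtr0_norm // ler_pM2r // norm_le_supnorm.
  + by rewrite mulr1 addrK normrM [`|t|]gtr0_norm // ler_pM2r // norm_le_supnorm.
  + by rewrite normrM [`|t|]gtr0_norm // ler_pM2r // norm_le_supnorm.
  + by rewrite mul0r mulr0 subrr normr0.
  + by abstract_norms => *; lra.
Qed.
(** Integrals make the coefficients of [H1] and [H2] exact; what survives is [f1] times the
    first-order error of conjugating [H1] for the time [integ 0 t f2]. *)
Lemma generalized_order1 :
  opnorm (evolution H2 (integ 0 h f2) *m evolution H1 (integ 0 h f1) - U h) <=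
  (nf1 * nf2 * c12) / 2 * h ^+ 2.
Proof.
have T0 : 0 <= T by rewrite (le_trans (ltW h0)).
have := @trotter_error _ _ _ _ hH1 hH2 f1 f2 (fun=> 0) (fun=> 0) (fun t => integ 0 t f2)
  f2 (fun t => integ 0 t f1) (fun=> 0) f1 (fun=> 0) U
  (nf1 * nf2 * c12) h 1 (ltW h0) erefl.
rewrite !integ0 evolution0 mul1mx; apply => //.
- by move=> t tin; exact: is_derive_integ f2_cont (in_T tin).
- by move=> t tin; rewrite add0r addr0; exact: is_derive_integ f1_cont (in_T tin).
- exact: within_const.
- exact: to_h (within_integ T0 f2_cont).
- exact: to_h (within_integ T0 f1_cont).
- move=> t tin; have tT := ltW2 (in_T tin).
  apply: (le_trans (error_terms_le (x1 := 0) (xr := 0) (x2 := 0) (xq := nf1)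
    (xb := nf2 * t) (x3 := 0) (xp := 0) (xf := nf2) (xa := 0) _ _ _ _ _ _ _ _ _ _ _ _ _ _));
    rewrite ?opnorm_ge0 ?norm_le_supnorm ?normr0 //.
  + by rewrite !add0r subrr normr0.
  + by rewrite subrr normr0.
  + exact: integ_le.
  + by rewrite mul0r mulr0 subrr normr0.
  + by abstract_norms => *; lra.
Qed.

Let is_derive_half (f : R -> R) (df t : R) : is_derive (t / 2) 1 f df ->
  is_derive t 1 (fun s => f (s / 2)) (df / 2).
Proof.
move=> hf; have dh : is_derive t 1 (fun s : R => s / 2) (2^-1 : R).
  have := is_derive_mul (is_derive_id t 1) (is_derive_const t (2^-1 : R)).
  by congr (is_derive _ _ _ _); ring.
have := @is_derive1_comp _ f (fun s => s / 2) t df (2^-1) hf dh.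
by congr (is_derive _ _ _ _); rewrite // mulrC.
Qed.

Let within_half (f : R -> R) : {within `[0, T], continuous f} ->
  {within `[0, h], continuous (fun s => f (s / 2))}.
Proof.
move=> cf; apply: (within_comp_within cf) => [s|]; last first.
  by move=> s; apply: cvgM; [exact: cvg_id|exact: cvg_cst].
rewrite /= !in_itv /= => /andP[s0 sh]; rewrite divr_ge0 //=.
by move: hT sh s0 => *; lra.
Qed.


(** The coefficients of [H1] and [H2] miss [f1 t] and [f2 t] by Taylor remainders at [t / 2], whence
    [1/8 = 1/2 * (1/2) ^+ 2]. In the derivative of [c], the part [f1 (t / 2) / 2] is expanded to
    second order, the part [t / 4 * df1 (t / 2)] to first order. *)
Lemma standard_order2 :
  opnorm (evolution H1 (h / 2 * f1 (h / 2)) *m evolution H2 (h * f2 (h / 2))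
    *m evolution H1 (h / 2 * f1 (h / 2)) - U h) <=
  (1/8 * ndd1 * nH1 + 1/8 * ndd2 * nH2 + 1/4 * (nd1 * nf2 + nf1 * nd2) * c12
   + 1/8 * nf1 ^+ 2 * nf2 * c112 + 1/4 * nf1 * nf2 ^+ 2 * c221) / 3 * h ^+ 3.
Proof.
have d1 (t : R) tin := is_derive_half (c2f1.1 _ (@half_in_T t tin)).1.
have d2 (t : R) tin := is_derive_half (c2f2.1 _ (@half_in_T t tin)).1.
have dh (t : R) : is_derive t 1 (fun s : R => s / 2) (2^-1 : R).
  by have := is_derive_half (is_derive_id (t / 2) 1); rewrite div1r.
have ch A : {within A, continuous (fun s : R => s / 2)}.
  by apply: within_mul; [exact: within_id|exact: within_const].
have := @trotter_error _ _ _ _ hH1 hH2 f1 f2 (fun t => t / 2 * f1 (t / 2))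
  (fun t => f1 (t / 2) / 2 + t / 4 * df1 (t / 2))
  (fun t => t * f2 (t / 2)) (fun t => f2 (t / 2) + t / 2 * df2 (t / 2))
  (fun t => t / 2 * f1 (t / 2)) (fun t => f1 (t / 2) / 2) (fun t => t / 4 * df1 (t / 2))
  (fun=> 0) U
  (1/8 * ndd1 * nH1 + 1/8 * ndd2 * nH2 + 1/4 * (nd1 * nf2 + nf1 * nd2) * c12
   + 1/8 * nf1 ^+ 2 * nf2 * c112 + 1/4 * nf1 * nf2 ^+ 2 * c221) h 2 (ltW h0).
rewrite !mul0r; apply => //.
- move=> t tin; have := is_derive_mul (dh t) (d1 t tin).
  by congr (is_derive _ _ _ _); field.
- move=> t tin; have := is_derive_mul (is_derive_id t 1) (d2 t tin).
  by congr (is_derive _ _ _ _); field.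
- move=> t tin; have := is_derive_mul (dh t) (d1 t tin).
  by congr (is_derive _ _ _ _); field.
- by apply: within_mul; [exact: ch|exact: within_half].
- by apply: within_mul; [exact: within_id|exact: within_half].
- by apply: within_mul; [exact: ch|exact: within_half].
- move=> t tin; have tT := ltW2 (in_T tin); have sT := ltW2 (half_in_T tin).
  have /andP[t0 th] := tin; have /andP[s0 _] := half_in_T tin.
  have st : t / 2 <= t by lra.
  have [_ tT'] := andP tT.
  have L2 := C2_lipschitz c2f2 (ltW s0) st tT'.
  have t1 := C2_taylor c2f1 (ltW s0) st tT'; have t2 := C2_taylor c2f2 (ltW s0) st tT'.
  have tt : t - t / 2 = t / 2 by lra.
  rewrite tt in L2 t1 t2.
  apply: (le_trans (error_terms_le (x1 := ndd1 / 2 * (t / 2) ^+ 2) (xr := 0)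
    (x2 := ndd2 / 2 * (t / 2) ^+ 2) (xq := t / 4 * nd1)
    (xb := t * nf2) (x3 := t / 2 * nf1 * (nd2 * (t / 2))) (xp := nf1 / 2) (xf := nf2)
    (xa := t / 2 * nf1) _ _ _ _ _ _ _ _ _ _ _ _ _ _));
    rewrite ?opnorm_ge0 ?norm_le_supnorm ?normr0 //.
  + apply: le_trans t1; rewrite -normrN le_eqVlt; apply/orP; left; apply/eqP.
    by congr (`|_|); field.
  + apply: le_trans t2; rewrite -normrN le_eqVlt; apply/orP; left; apply/eqP.
    by congr (`|_|); field.
  + rewrite normrM ger0_norm ?divr_ge0 ?(ltW t0) // ler_pM2l ?divr_gt0 //.
    exact: norm_le_supnorm.
  + rewrite normrM gtr0_norm // ler_pM2l //; exact: norm_le_supnorm.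
  (* The two products differ only in where [f2] is evaluated, which leaves its increment over
     [[t / 2, t]]. *)
  + have -> : f1 (t / 2) / 2 * (t * f2 (t / 2)) - f2 t * (t / 2 * f1 (t / 2)) =
      t / 2 * f1 (t / 2) * - (f2 t - f2 (t / 2)) by field.
    rewrite normrM normrN; apply: ler_pM => //.
    rewrite normrM gtr0_norm // ler_pM2l //; exact: norm_le_supnorm.
  + rewrite normrM [`|2^-1|]ger0_norm // ler_pM2r //; exact: norm_le_supnorm.
  + rewrite normrM gtr0_norm // ler_pM2l //; exact: norm_le_supnorm.
  + by rewrite le_eqVlt; apply/orP; left; apply/eqP; abstract_norms => *; field.
Qed.

Lemma generalized_order2 :
  opnorm (evolution H1 (integ (h / 2) h f1) *m evolution H2 (integ 0 h f2)
    *m evolution H1 (integ 0 (h / 2) f1) - U h) <=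
  ((3/4 * nf1 * nd2 + 1/8 * nd1 * nf2) * c12
   + 1/8 * nf1 ^+ 2 * nf2 * c112 + 1/4 * nf1 * nf2 ^+ 2 * c221) / 3 * h ^+ 3.
Proof.
have T0 : 0 <= T by rewrite (le_trans (ltW h0)).
have h2h : h / 2 <= h by move: h0 => *; lra.
have h20 : 0 <= h / 2 by rewrite divr_ge0 // ltW.
(* A difference of integrals from [0] can be differentiated in both moving endpoints. *)
rewrite (integ_sub f1_cont h20 h2h hT).
have dF1 (t : R) tin := is_derive_integ f1_cont (@in_T t tin).
have dF1h (t : R) tin := is_derive_half (is_derive_integ f1_cont (@half_in_T t tin)).
have := @trotter_error _ _ _ _ hH1 hH2 f1 f2 (fun t => integ 0 t f1 - integ 0 (t / 2) f1)
  (fun t => f1 t - f1 (t / 2) / 2) (fun t => integ 0 t f2) f2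
  (fun t => integ 0 (t / 2) f1) (fun t => f1 (t / 2) / 2) (fun=> 0) (fun=> 0) U
  ((3/4 * nf1 * nd2 + 1/8 * nd1 * nf2) * c12
   + 1/8 * nf1 ^+ 2 * nf2 * c112 + 1/4 * nf1 * nf2 ^+ 2 * c221) h 2 (ltW h0).
rewrite !mul0r !integ0 subrr; apply => //.
- by move=> t tin; apply: is_derive_add; [exact: dF1|apply: is_derive_opp; exact: dF1h].
- by move=> t tin; exact: is_derive_integ f2_cont (in_T tin).
- by move=> t tin; rewrite !addr0; exact: dF1h.
- apply: within_add; first exact: to_h (within_integ T0 f1_cont).
  by apply: within_opp; exact: within_half (within_integ T0 f1_cont).
- exact: to_h (within_integ T0 f2_cont).
- exact: within_half (within_integ T0 f1_cont).
- move=> t tin; have tT := ltW2 (in_T tin); have sT := ltW2 (half_in_T tin).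
  have /andP[t0 th] := tin; have /andP[s0 _] := half_in_T tin.
  have st : t / 2 <= t by lra.
  have [_ tT'] := andP tT.
  have tt : t - t / 2 = t / 2 by lra.
  have L2 := C2_lipschitz c2f2 (lexx 0) (ltW t0) tT'.
  have t1 := integ_taylor c2f1 (ltW s0) st tT'.
  have t2 := integ_taylor c2f2 (lexx 0) (ltW t0) tT'.
  rewrite tt in t1; rewrite integ0 !subr0 in t2 L2.
  apply: (le_trans (error_terms_le (x1 := 0) (xr := 0)
    (x2 := 0) (xq := 0) (xb := nf2 * t)
    (x3 := nf1 / 2 * (nd2 / 2 * t ^+ 2 + t * (nd2 * t)) + nf2 * (nd1 / 2 * (t / 2) ^+ 2))
    (xp := nf1 / 2) (xf := nf2)
    (xa := nf1 * (t / 2)) _ _ _ _ _ _ _ _ _ _ _ _ _ _));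
    rewrite ?opnorm_ge0 ?norm_le_supnorm ?normr0 //.
  + by rewrite addr0 subrK subrr normr0.
  + by rewrite subrr normr0.
  + exact: integ_le.
  (* Both products have leading part [t / 2 * f1 (t / 2) * f2 t]. Passing from the integral of [f2]
     to [t * f2 0] and then to [t * f2 t] costs [1/2 + 1] times [nd2 * t ^+ 2], whence [3/4]; the
     remainder of the integral of [f1], over length [t / 2], gives [1/8]. *)
  + have -> : f1 (t / 2) / 2 * integ 0 t f2 - f2 t * (integ 0 t f1 - integ 0 (t / 2) f1) =
      f1 (t / 2) / 2 * ((integ 0 t f2 - t * f2 0) - t * (f2 t - f2 0))
      - f2 t * (integ 0 t f1 - integ 0 (t / 2) f1 - t / 2 * f1 (t / 2)) by field.
    rewrite (le_trans (ler_normB _ _)) //; apply: lerD; rewrite normrM; apply: ler_pM => //.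
    * by rewrite normrM [`|2^-1|]ger0_norm // ler_pM2r // norm_le_supnorm.
    * rewrite (le_trans (ler_normB _ _)) //; apply: lerD => //.
      by rewrite normrM gtr0_norm // ler_pM2l.
    * exact: norm_le_supnorm.
  + by rewrite normrM [`|2^-1|]ger0_norm // ler_pM2r // norm_le_supnorm.
  + have := @norm_sub_le _ (fun s => integ 0 s f1) f1 nf1 (t / 2) t st.
    rewrite tt; apply.
    * move=> u /andP[tu ut]; apply: is_derive_integ f1_cont _.
      by rewrite (lt_trans s0) //= (lt_le_trans ut).
    * by apply: within_itvW (within_integ T0 f1_cont) => //; exact: ltW.
    * move=> u /andP[tu ut]; apply: norm_le_supnorm => //.
      by rewrite ltW ?(lt_trans s0) //= ltW // (lt_le_trans ut).
  + by rewrite le_eqVlt; apply/orP; left; apply/eqP; abstract_norms => *; field.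
Qed.

End OneStep.

(** * Comparison with the stated constants *)

Ltac nonneg := lazymatch goal with
  | |- is_true (0 <= _ + _) => apply: addr_ge0; nonneg
  | |- is_true (0 <= _ * _) => apply: mulr_ge0; nonneg
  | |- is_true (0 <= _ ^+ _) => apply: exprn_ge0; nonneg
  | |- is_true (0 <= _^-1) => rewrite invr_ge0; nonneg
  | |- is_true (0 <= _%:R) => exact: ler0n
  | |- is_true (0 <= 1) => exact: ler01
  | _ => assumption
  end.

Lemma standard_order1_constants (R : realType) (h nf1 nf2 nd1 nd2 nH1 nH2 c12 : R) :
  0 <= h -> 0 <= nf1 -> 0 <= nd2 -> 0 <= c12 ->
  (nd1 * nH1 + nd2 * nH2 + nf1 * nf2 * c12) / 2 * h ^+ 2 <=
  (1/2 * nd1 * nH1 + 1/2 * nd2 * nH2 + 1/2 * nf1 * nf2 * c12) * h ^+ 2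
  + 1/6 * nf1 * nd2 * c12 * h ^+ 3.
Proof.
move=> *; apply: ler_wpDr; first nonneg.
by rewrite le_eqVlt; apply/orP; left; apply/eqP; field.
Qed.

Lemma standard_order2_constants (R : realType)
    (h nf1 nf2 nd1 nd2 ndd1 ndd2 nH1 nH2 c12 c112 c212 : R) :
  0 <= h -> 0 <= nf1 -> 0 <= nf2 -> 0 <= nd1 -> 0 <= nd2 -> 0 <= ndd1 -> 0 <= ndd2 ->
  0 <= nH1 -> 0 <= nH2 -> 0 <= c12 -> 0 <= c112 -> 0 <= c212 ->
  (1/8 * ndd1 * nH1 + 1/8 * ndd2 * nH2 + 1/4 * (nd1 * nf2 + nf1 * nd2) * c12
   + 1/8 * nf1 ^+ 2 * nf2 * c112 + 1/4 * nf1 * nf2 ^+ 2 * c212) / 3 * h ^+ 3 <=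
  (7/24 * ndd1 * nH1 + 1/12 * nd1 * nf2 * nH1 + 7/24 * ndd2 * nH2
    + 1/6 * (nd1 * nf2 + nf1 * nd2) * c12
    + 1/24 * nf1 ^+ 2 * nf2 * c112 + 1/12 * nf1 * nf2 ^+ 2 * c212) * h ^+ 3
  + (1/64 * nd1 * nd2 * nH1
    + (1/192 * nf1 * ndd2 + 1/192 * ndd1 * nf2 + 1/48 * nd1 * nd2) * c12
    + 1/96 * nf1 * nd1 * nf2 * c112 + 1/48 * nf1 * nf2 * nd2 * c212) * h ^+ 4
  + (1/960 * nd1 ^+ 2 * nf2 * c112 + 1/480 * nf1 * nd2 ^+ 2 * c212) * h ^+ 5.
Proof.
move=> *; rewrite -!addrA; apply: ler_wpDr; last first.
  rewrite -subr_ge0 -mulrBl mulr_ge0 ?exprn_ge0 //.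
  (* The differences are [7/24 - 1/24], the whole term [1/12 * nd1 * nf2 * nH1], and [1/6 - 1/12];
     the coefficients of the double commutators agree. *)
  rewrite [X in 0 <= X](_ : _ = 1/4 * ndd1 * nH1 + 1/12 * nd1 * nf2 * nH1
    + 1/4 * ndd2 * nH2 + 1/12 * (nd1 * nf2 + nf1 * nd2) * c12); last by field.
  nonneg.
nonneg.
Qed.

Lemma generalized_order2_constants (R : realType)
    (h nf1 nf2 nd1 nd2 c12 c112 c221 : R) :
  0 <= h -> 0 <= nf1 -> 0 <= nf2 -> 0 <= nd1 -> 0 <= nd2 ->
  0 <= c12 -> 0 <= c112 -> 0 <= c221 ->
  ((3/4 * nf1 * nd2 + 1/8 * nd1 * nf2) * c12
   + 1/8 * nf1 ^+ 2 * nf2 * c112 + 1/4 * nf1 * nf2 ^+ 2 * c221) / 3 * h ^+ 3 <=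
  ((7/12 * nf1 * nd2 + 11/24 * nd1 * nf2) * c12
   + 3/8 * nf1 ^+ 2 * nf2 * c112 + 1/12 * nf1 * nf2 ^+ 2 * c221) * h ^+ 3.
Proof.
move=> *; rewrite -subr_ge0 -mulrBl mulr_ge0 ?exprn_ge0 //.
(* The differences are [7/12 - 1/4], [11/24 - 1/24] and [3/8 - 1/24]; the coefficients of [c221]
   agree. *)
rewrite [X in 0 <= X](_ : _ = (1/3 * nf1 * nd2 + 5/12 * nd1 * nf2) * c12
  + 1/3 * nf1 ^+ 2 * nf2 * c112); last by field.
nonneg.
Qed.

Theorem theorem1 (R : realType) (n : nat) (H1 H2 : 'M[complex R]_n)
  (T h : R) (f1 df1 ddf1 f2 df2 ddf2 : R -> R) (U : R -> 'M[complex R]_n) :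
  is_hermitian H1 -> is_hermitian H2 ->
  C2_on T f1 df1 ddf1 -> C2_on T f2 df2 ddf2 ->
  0 < h -> h <= T ->
  (* U t = U(t,0): exact evolution for H(t) = f1(t) H1 + f2(t) H2 *)
  U 0 = 1%:M ->
  mx_continuous_on `[0, T] U ->
  (forall t, 0 < t < T ->
     mx_has_deriv U
       ((- iC) *: ((RtoC (f1 t) *: H1 + RtoC (f2 t) *: H2) *m U t)) t) ->
  let nf1 := supnorm T f1 in let nf2 := supnorm T f2 in
  let nd1 := supnorm T df1 in let nd2 := supnorm T df2 in
  let ndd1 := supnorm T ddf1 in let ndd2 := supnorm T ddf2 in
  let nH1 := opnorm H1 in let nH2 := opnorm H2 in
  let c12 := opnorm (mcomm H1 H2) in
  let c112 := opnorm (mcomm H1 (mcomm H1 H2)) in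
  let c212 := opnorm (mcomm H2 (mcomm H1 H2)) in
  let c221 := opnorm (mcomm H2 (mcomm H2 H1)) in
  let E (c : R) (A : 'M[complex R]_n) := expm ((- iC * RtoC c) *: A) in
  let Us1 := E (f2 h * h) H2 *m E (f1 h * h) H1 in
  let Ug1 := E (integ 0 h f2) H2 *m E (integ 0 h f1) H1 in
  let Us2 := E (h / 2 * f1 (h / 2)) H1 *m E (h * f2 (h / 2)) H2
             *m E (h / 2 * f1 (h / 2)) H1 in
  let Ug2 := E (integ (h / 2) h f1) H1 *m E (integ 0 h f2) H2
             *m E (integ 0 (h / 2) f1) H1 in
  let as1 := 1/2 * nd1 * nH1 + 1/2 * nd2 * nH2 + 1/2 * nf1 * nf2 * c12 in
  let bs1 := 1/6 * nf1 * nd2 * c12 in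
  let ag1 := 1/2 * nf1 * nf2 * c12 in
  let as2 := 7/24 * ndd1 * nH1 + 1/12 * nd1 * nf2 * nH1 + 7/24 * ndd2 * nH2
             + 1/6 * (nd1 * nf2 + nf1 * nd2) * c12
             + 1/24 * nf1 ^+ 2 * nf2 * c112 + 1/12 * nf1 * nf2 ^+ 2 * c212 in
  let bs2 := 1/64 * nd1 * nd2 * nH1
             + (1/192 * nf1 * ndd2 + 1/192 * ndd1 * nf2 + 1/48 * nd1 * nd2) * c12
             + 1/96 * nf1 * nd1 * nf2 * c112 + 1/48 * nf1 * nf2 * nd2 * c212 in
  let gs2 := 1/960 * nd1 ^+ 2 * nf2 * c112 + 1/480 * nf1 * nd2 ^+ 2 * c212 in
  let ag2 := (7/12 * nf1 * nd2 + 11/24 * nd1 * nf2) * c12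
             + 3/8 * nf1 ^+ 2 * nf2 * c112 + 1/12 * nf1 * nf2 ^+ 2 * c221 in
  [/\ opnorm (Us1 - U h) <= as1 * h ^+ 2 + bs1 * h ^+ 3,
      opnorm (Ug1 - U h) <= ag1 * h ^+ 2,
      opnorm (Us2 - U h) <= as2 * h ^+ 3 + bs2 * h ^+ 4 + gs2 * h ^+ 5 &
      opnorm (Ug2 - U h) <= ag2 * h ^+ 3].
Proof.
move=> hH1 hH2 C1 C2 h0 hT U0 cU dU nf1 nf2 nd1 nd2 ndd1 ndd2 nH1 nH2 c12 c112 c212 c221 E
  Us1 Ug1 Us2 Ug2 as1 bs1 ag1 as2 bs2 gs2 ag2.
have T0 : 0 <= T by exact: le_trans (ltW h0) hT.
have EE c A : E c A = evolution A c by rewrite evolution.unlock.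
have e1 := standard_order1 hH1 hH2 C1 C2 h0 hT U0 cU dU.
have e2 := generalized_order1 hH1 hH2 C1 C2 h0 hT U0 cU dU.
have e3 := standard_order2 hH1 hH2 C1 C2 h0 hT U0 cU dU.
have e4 := generalized_order2 hH1 hH2 C1 C2 h0 hT U0 cU dU.
(* [[H2, [H1, H2]]] and [[H2, [H2, H1]]] differ by a sign. *)
have c221E : c221 = c212 by rewrite /c221 /c212 (mcommC H1 H2) mcommNr opnormN.
rewrite -!EE -/c221 c221E in e1 e2 e3 e4.
have [_ [k1 [k2 k3]]] := C1; have [_ [k4 [k5 k6]]] := C2.
have p1 := supnorm_ge0 T0 k1; have p2 := supnorm_ge0 T0 k4.
have p3 := supnorm_ge0 T0 k2; have p4 := supnorm_ge0 T0 k5.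
have p5 := supnorm_ge0 T0 k3; have p6 := supnorm_ge0 T0 k6.
have q1 := opnorm_ge0 H1; have q2 := opnorm_ge0 H2; have q3 := opnorm_ge0 (mcomm H1 H2).
have q4 := opnorm_ge0 (mcomm H1 (mcomm H1 H2)); have q5 := opnorm_ge0 (mcomm H2 (mcomm H1 H2)).
split.
- apply: (le_trans e1); exact: (standard_order1_constants _ _ _ _ (ltW h0) p1 p4 q3).
- apply: (le_trans e2); rewrite /ag1 /nf1 /nf2 /c12; move: (supnorm T f1) (supnorm T f2) (opnorm _).
  by move=> a b c; rewrite le_eqVlt; apply/orP; left; apply/eqP; field.
- apply: (le_trans e3).
  exact: (standard_order2_constants (ltW h0) p1 p2 p3 p4 p5 p6 q1 q2 q3 q4 q5).
- apply: (le_trans e4); rewrite /ag2 c221E.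
  exact: (generalized_order2_constants (ltW h0) p1 p2 p3 p4 q3 q4 q5).
Qed.
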